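(* For every $\epsilon > 0$ there is a constant $c_\epsilon > 0$ such that for every $N \ge 1$ and every set $P \subset \mathbb{R}^2$ of $N$ points, $P$ determines at least $c_\epsilon N^{1-\epsilon}$ distinct distances, i.e. $|d(P)| \ge c_\epsilon N^{1-\epsilon}$.
   Context: For a set $P \subset \mathbb{R}^2$, the set of distinct distances determined by $P$ is $d(P) := \{ |p_1 - p_2| : p_1, p_2 \in P \}$, where $|\cdot|$ is the Euclidean norm. *)

(* Defs.v *)
From mathcomp Require Import all_boot all_order all_algebra.
From mathcomp Require Import finmap.
From mathcomp Require Import reals exp.

Set Implicit Arguments.
Unset Strict Implicit.
Unset Printing Implicit Defensive.

Import Order.TTheory GRing.Theory Num.Theory.
Local Open Scope ring_scope.
Local Open Scope fset_scope.

(* The plane is [R * R]. The distance is spelled out because the library norm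
   on [R * R] (and on row vectors) is the sup norm, not the Euclidean one. *)
Definition euclidean_dist (R : realType) (p q : R * R) : R :=
  Num.sqrt ((p.1 - q.1) ^+ 2 + (p.2 - q.2) ^+ 2).

(* The pairs with [p1 = p2] are included, so [0] is counted when [P] is
   nonempty. *)
Definition distinct_distances (R : realType) (P : {fset R * R}) : {fset R} :=
  [fset euclidean_dist p1 p2 | p1 in P, p2 in P].

(* Main.v *)
(* By the Cauchy-Schwarz inequality it suffices to show that O(N^(3+eps)) quadruples satisfy
   |p - p'| = |q - q'|. To (p, q) attach the line l_pq in R^3 which parametrizes the
   rotations taking p to q (Elekes-Sharir): a quadruple in which q - q' is not p - p' makes
   l_pq and l_p'q' meet, so one has to show that these N^2 lines have
   O(N^(3+eps) / r^2) points on r lines or more.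

   As in Guth's proof, this is done by induction on the number of lines, with a polynomial
   partition of bounded degree, after setting aside the points that are rich within an
   irreducible surface of bounded degree containing many of the lines. Two such surfaces share
   O(1) lines, and each contains only O(N) of the lines l_pq: if it contained many of them for
   two values of p, it would be tangent to two vector fields, and this makes it a union of
   planes t = constant, which contain no line l_pq.

   The polynomial ham sandwich theorem is replaced by an averaging argument without topology:
   a functional vanishing at a random point of each of m finite sets of vectors separates,
   on average, a positive proportion of the pairs of points in each of the sets. Splitting the
   large cells repeatedly gives cells with at most a proportion 1/M of the points, with a
   product of polynomials of degree O(M^(1/3) log M); the logarithm costs only an eps. *)
Require Import Defs.
From mathcomp Require Import all_boot all_order all_algebra.
From mathcomp Require Import finmap.
From mathcomp Require Import reals exp.
From mathcomp Require Import boolp ring lra zify.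

Set Implicit Arguments.
Unset Strict Implicit.
Unset Printing Implicit Defensive.

Import Order.TTheory GRing.Theory Num.Theory.
Local Open Scope ring_scope.

(** * Unique factorization of polynomials *)

Section UniqueFactorization.

(** The exponent comes from the following balance. A partition of degree d has about M = d^3 cells
    and a line meets O(d log d) of them, so an average cell meets O(n log d / d^2) of n lines. If
    the bound is K n theta(n) with theta(n) = c n^p, the cells together reproduce it with a factor D
    (D / M)^p, where D = O(d log d); this is d^(1 - 2p) up to logarithms. So p = 1/2 + eps works
    with a large fixed d, the gain d^(-2 eps) beating the logarithms. The surfaces set aside are
    those with at least theta(n) of the lines, and theta(n)^2 >= 2 B0 n, with B0 the number of lines
    two of them may share, keeps their total number of lines below 2n.

    Lines are handled algebraically: a line (X(t), Y(t), t) is a point (X, Y) of the plane over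
    R[t], and it lies in a surface when this point is a zero of its equation. Lines common to two
    surfaces are then common zeros of two bivariate polynomials over the domain R[t], which is why a
    Bezout bound is proved over a unique factorization domain. *)

Definition divides (A : idomainType) (a b : A) := exists c, b = c * a.

Definition irred (A : idomainType) (p : A) :=
  [/\ p != 0, p \isn't a GRing.unit
    & forall b c, p = b * c -> b \is a GRing.unit \/ c \is a GRing.unit].

(** The measure [mu] makes factorization stop, and irreducible elements being prime makes it unique.
    In this form the property passes to [{poly A}] without gcds or contents. *)
Definition ufd (A : idomainType) :=
  (exists mu : A -> nat, forall a b, a * b != 0 ->
     (mu a <= mu (a * b)%R)%N /\
     (b \isn't a GRing.unit -> (mu a < mu (a * b)%R)%N)) /\
  (forall p : A, irred p ->
     forall a b, divides p (a * b) -> divides p a \/ divides p b).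

Lemma dividesMl (A : idomainType) (a b c : A) : divides a b -> divides a (c * b).
Proof. by case=> d ->; exists (c * d); rewrite mulrA. Qed.

Lemma dividesMr (A : idomainType) (a b c : A) : divides a b -> divides a (b * c).
Proof. by rewrite mulrC; apply: dividesMl. Qed.

Lemma dividesD (A : idomainType) (a b c : A) :
  divides a b -> divides a c -> divides a (b + c).
Proof. by case=> x -> [y ->]; exists (x + y); rewrite mulrDl. Qed.

Lemma dividesN (A : idomainType) (a b : A) : divides a b -> divides a (- b).
Proof. by case=> x ->; exists (- x); rewrite mulNr. Qed.

Lemma divides0 (A : idomainType) (a : A) : divides a 0.
Proof. by exists 0; rewrite mul0r. Qed.

Lemma irred_divides_irred (A : idomainType) (p q : A) :
  irred p -> irred q -> divides p q -> divides q p.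
Proof.
case=> p0 pu _ [q0 qu qirr] [c qE].
case: (qirr _ _ qE) => [cu|pu']; last by rewrite pu' in pu.
by exists c^-1; rewrite qE mulrA mulVr // mul1r.
Qed.

Section Atomic.
Variable A : idomainType.
Hypothesis uA : ufd A.

Lemma exists_irred_divisor (a : A) : a != 0 -> a \isn't a GRing.unit ->
  exists2 p, irred p & divides p a.
Proof.
case: uA => -[mu muP] _; have [n] := ubnP (mu a).
elim: n a => // n IHn a; rewrite ltnS => le_an a0 au.
have [airr|] := pselect (irred a); first by exists a => //; exists 1; rewrite mul1r.
move=> nirr.
have [b [c [aE bu cu]]] : exists b c, [/\ a = b * c, b \isn't a GRing.unit
   & c \isn't a GRing.unit].
  apply: contrapT => nex; apply: nirr; split=> // b c aE.
  have [bu|bu] := boolP (b \is a GRing.unit); first by left.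
  have [cu|cu] := boolP (c \is a GRing.unit); first by right.
  by case: nex; exists b, c.
have b0 : b != 0 by apply: contraNneq a0 => b0; rewrite aE b0 mul0r.
have [p pirr pb] : exists2 p, irred p & divides p b.
  apply: IHn => //; apply: leq_trans le_an.
  by have := muP b c; rewrite -aE => /(_ a0) [_]; apply.
by exists p => //; rewrite aE; apply: dividesMr.
Qed.

(** This stands in for the content of a polynomial: a constant factor is removed one prime at a
    time. *)
Lemma ufd_ind (P : A -> Prop) :
  (forall u, u \is a GRing.unit -> P u) ->
  (forall p a, irred p -> a != 0 -> P a -> P (p * a)) ->
  forall a, a != 0 -> P a.
Proof.
move=> Pu Pm a; case: (uA) => -[mu muP] _; have [n] := ubnP (mu a).
elim: n a => // n IHn a; rewrite ltnS => le_an a0.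
have [au|au] := boolP (a \is a GRing.unit); first exact: Pu.
have [p pirr [b aE]] := exists_irred_divisor a0 au.
have b0 : b != 0 by apply: contraNneq a0 => b0; rewrite aE b0 mul0r.
rewrite aE mulrC; apply: Pm => //; apply: IHn => //; apply: leq_trans le_an.
have := muP b p; rewrite -aE => /(_ a0) [_]; apply.
by case: pirr.
Qed.

End Atomic.

Section PolyUfd.
Variable A : idomainType.
Hypothesis uA : ufd A.

(** Gauss's lemma. [p] divides the product of the leading coefficients, hence one of them; removing
    that leading term changes the factor by a multiple of [p] and makes it shorter. *)
Lemma divides_polyC_mul (p : A) (f g : {poly A}) : irred p ->
  divides p%:P (f * g) -> divides p%:P f \/ divides p%:P g.
Proof.
move=> pirr; have [n] := ubnP (size f + size g).
elim: n f g => // n IHn f g; rewrite ltnS => le_n dv.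
have [->|f0] := eqVneq f 0; first by left; apply: divides0.
have [->|g0] := eqVneq g 0; first by right; apply: divides0.
have peel (h : {poly A}) : h != 0 -> divides p (lead_coef h) ->
    exists2 h' : {poly A}, (size h' < size h)%N & exists2 k, divides p%:P k & h = h' + k.
  move=> h0 [c hE]; exists (h - c%:P * p%:P * 'X^((size h).-1)); last first.
    exists (c%:P * p%:P * 'X^((size h).-1)); last by rewrite subrK.
    by exists (c%:P * 'X^((size h).-1)); rewrite mulrAC.
  rewrite -polyCM -hE mul_polyC.
  rewrite [X in (_ < X)%N]polySpred // ltnS; apply/leq_sizeP => j le_j.
  rewrite coefB coefZ coefXn; case: (eqVneq j (size h).-1) => [->|ne].
    by rewrite mulr1 lead_coefE subrr.
  rewrite mulr0 subr0 nth_default // polySpred // ltn_neqAle le_j andbT.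
  by rewrite eq_sym.
have /(uA.2 _ pirr) [] : divides p (lead_coef f * lead_coef g).
    case: dv => c /(congr1 lead_coef).
    by rewrite !lead_coefM lead_coefC => E; exists (lead_coef c).
  move=> /(peel _ f0) [f' ltf [k dk fE]].
  have [||?|] := IHn f' g; last by right.
  - by apply: leq_trans le_n; rewrite ltn_add2r.
  - have -> : f' * g = f * g + - (k * g) by rewrite fE; ring.
    by apply: dividesD => //; apply/dividesN/dividesMr.
  - by left; rewrite fE; apply: dividesD.
move=> /(peel _ g0) [g' ltg [k dk gE]].
have [||?|?] := IHn f g'; first 2 last.
- by left.
- by right; rewrite gE; apply: dividesD.
- by apply: leq_trans le_n; rewrite ltn_add2l.
- have -> : f * g' = f * g + - (f * k) by rewrite gE; ring.
  by apply: dividesD => //; apply/dividesN/dividesMl.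
Qed.

Lemma unit_polyC (c : A) : (c%:P \is a GRing.unit) = (c \is a GRing.unit).
Proof.
rewrite poly_unitE coefC eqxx; have [->|c0] := eqVneq c 0.
  by rewrite size_poly0 unitr0.
by rewrite size_polyC c0.
Qed.

Lemma unit_size1 (p : {poly A}) : p \is a GRing.unit -> size p = 1%N.
Proof. by rewrite poly_unitE => /andP[/eqP]. Qed.

(** A prime [q] of [c] divides [w * p]. It cannot divide [p], which is irreducible of positive
    degree, so it divides [w] and can be cancelled. *)
Lemma irred_divides_cancel (p b : {poly A}) (c : A) : irred p ->
  (1 < size p)%N -> c != 0 -> divides p (c%:P * b) -> divides p b.
Proof.
move=> pirr sp c0; move: c c0 b.
apply: (ufd_ind uA) => [u uu b [w E]|q a qirr a0 IHa b [w E]].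
  exists (u^-1%:P * w); rewrite -mulrA -E mulrA -polyCM mulVr // mul1r.
  by [].
have /(divides_polyC_mul qirr) [] : divides q%:P (w * p).
  by exists (a%:P * b); rewrite -E polyCM; ring.
  move=> [w' wE]; apply: IHa; exists w'.
  have q0 : q%:P != 0 by rewrite polyC_eq0; case: qirr.
  by apply: (mulfI q0); move: E; rewrite wE polyCM -mulrA => ->; ring.
move=> [p' pE]; have [_ _ /(_ _ _ pE)] := pirr; case.
  move=> /unit_size1 s1; move: sp; rewrite pE mulrC.
  by rewrite size_Cmul ?s1 //; case: qirr.
by rewrite unit_polyC; case: qirr => _ /negP.
Qed.

(** A factorization over the field of fractions, with denominator [c], descends to [A] with the same
    degrees. *)
Lemma gauss_factor (c : A) (p h q : {poly A}) : c != 0 -> c%:P * p = h * q ->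
  exists h' q', [/\ p = h' * q', size h' = size h & size q' = size q].
Proof.
move=> c0; move: c c0 h q.
apply: (ufd_ind uA) => [u uu h q E|a c airr c0 IHc h q E].
  exists (u^-1%:P * h), q; split=> //.
    by rewrite -mulrA -E mulrA -polyCM mulVr // mul1r.
  by rewrite size_Cmul // invr_neq0 //; apply: contraTneq uu => ->; rewrite unitr0.
have a0 : a != 0 by case: airr.
have a0' : a%:P != 0 by rewrite polyC_eq0.
have /(divides_polyC_mul airr) [] : divides a%:P (h * q).
  by exists (c%:P * p); rewrite -E polyCM; ring.
  move=> [h1 hE]; have [|h' [q' [pE sh sq]]] := IHc h1 q.
    by apply: (mulfI a0'); move: E; rewrite hE polyCM -mulrA => ->; ring.
  by exists h', q'; split=> //; rewrite sh hE mulrC size_Cmul.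
move=> [q1 qE]; have [|h' [q' [pE sh sq]]] := IHc h q1.
  by apply: (mulfI a0'); move: E; rewrite qE polyCM -mulrA => ->; ring.
by exists h', q'; split=> //; rewrite sq qE mulrC size_Cmul.
Qed.

(** [gcdp] is a gcd only up to pseudo-division. [gauss_factor] turns it into a genuine factor of
    [p], whose cofactor must be constant; the remaining denominators are then cancelled. *)
Lemma irred_gcdp_divides (p a : {poly A}) : irred p -> (1 < size p)%N ->
  (1 < size (gcdp p a))%N -> divides p a.
Proof.
move=> pirr sp; set h := gcdp p a => sh.
have p0 : p != 0 by case: pirr.
have /Pdiv.Idomain.dvdpP [[c1 q1] /= c10 E1] : h %| p by apply: dvdp_gcdl.
have /Pdiv.Idomain.dvdpP [[c2 q2] /= c20 E2] : h %| a by apply: dvdp_gcdr.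
rewrite -!mul_polyC in E1 E2.
have [h' [q' [pE sh' sq']]] : exists h' q',
   [/\ p = h' * q', size h' = size h & size q' = size q1].
  by apply: (gauss_factor c10); rewrite E1 mulrC.
have [_ _ /(_ _ _ pE)] := pirr; case=> [/unit_size1 s1|/unit_size1 s1].
  by move: sh; rewrite -sh' s1.
move: sq'; rewrite s1 => /esym/eqP/size_poly1P [d d0 dE].
apply: (@irred_divides_cancel _ _ (d * c2)) => //; first by rewrite mulf_neq0.
exists (q2 * c1%:P); rewrite polyCM -mulrA E2 -mulrA E1 dE; ring.
Qed.

(** The measure is the size plus the measure of the leading coefficient. If [p] has positive degree
    and no common factor with [a], the nonzero constant [resultant p a] is a combination of both, so
    [p] divides its product with [b], and the constant is cancelled. *)
Lemma ufd_poly : ufd {poly A}.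
Proof.
split.
  case: (uA) => -[mu muP] _; exists (fun p : {poly A} => (size p + mu (lead_coef p))%N).
  move=> a b ab0; have a0 : a != 0 by apply: contraNneq ab0 => ->; rewrite mul0r.
  have b0 : b != 0 by apply: contraNneq ab0 => ->; rewrite mulr0.
  have lab0 : lead_coef a * lead_coef b != 0 by rewrite mulf_neq0 ?lead_coef_eq0.
  have [m1 m2] := muP _ _ lab0.
  rewrite lead_coefM size_mul //.
  have sb : (0 < size b)%N by rewrite size_poly_gt0.
  split; first by apply: leq_add => //; lia.
  move=> bu; have [s1|s1] := leqP (size b) 1.
    have sb1 : size b = 1%N by apply/eqP; rewrite eqn_leq s1.
    rewrite sb1 addn1 /= ltn_add2l; apply: m2; apply: contraNN bu.
    by rewrite poly_unitE sb1 eqxx lead_coefE sb1.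
  by rewrite -addSn; apply: leq_add => //; lia.
move=> p pirr a b dv; have [p0 pu pI] := pirr.
have [s1|s1] := leqP (size p) 1.
  have pE : p = (p`_0)%:P by apply: size1_polyC.
  have cirr : irred p`_0.
    split.
    - by apply: contraNneq p0 => c0; rewrite pE c0.
    - by rewrite -unit_polyC -pE.
    - by move=> x y E; rewrite -!unit_polyC; apply: pI; rewrite -polyCM -E.
  by move: dv; rewrite pE; apply: divides_polyC_mul.
have [sg|sg] := ltnP 1 (size (gcdp p a)).
  by left; apply: irred_gcdp_divides.
right; have [a1|a1] := leqP (size a) 1.
  have aE : a = (a`_0)%:P by apply: size1_polyC.
  have [a0|a0] := eqVneq a`_0 0.
    by move: sg; rewrite aE a0 gcdp0 leqNgt s1.
  by apply: (irred_divides_cancel pirr s1 a0); rewrite -aE.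
have [[u v] /= [_ _ E]] := resultant_in_ideal s1 a1.
have r0 : resultant p a != 0 by rewrite resultant_eq0 -leqNgt.
apply: (irred_divides_cancel pirr s1 r0).
rewrite E mulrDl; apply: dividesD; first by exists (u * b); ring.
by rewrite -mulrA; apply: dividesMl.
Qed.

End PolyUfd.

Lemma ufd_field (F : fieldType) : ufd F.
Proof.
split.
  exists (fun _ => 0%N) => a b ab0; split=> //; rewrite unitfE negbK => /eqP b0.
  by rewrite b0 mulr0 eqxx in ab0.
by move=> p [p0]; rewrite unitfE p0.
Qed.

End UniqueFactorization.

(** * Common zeros of two polynomials *)

Section FiniteCounting.

Lemma card_fibers_le (T : finType) (K : eqType) (Z : {set T}) (h : T -> K)
    (s : seq K) (b : nat) :
  (forall x, x \in Z -> h x \in s) ->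
  (forall k, k \in s -> (#|[set x in Z | h x == k]| <= b)%N) ->
  (#|Z| <= size s * b)%N.
Proof.
elim: s Z => [|k s IHs] Z hs hb.
  rewrite leqn0 cards_eq0; apply/eqP/setP => x; rewrite inE.
  by apply/negP => /hs.
rewrite -(cardsID [set x | h x == k]) /= mulSn; apply: leq_add.
  have := hb k (mem_head _ _); congr (_ <= _)%N; apply: eq_card => x.
  by rewrite !inE.
apply: IHs => [x|j js].
  by rewrite !inE => /andP[/negPf ne /hs]; rewrite inE ne.
apply: leq_trans (hb j _); last by rewrite inE js orbT.
by apply: subset_leq_card; apply/subsetP => x; rewrite !inE => /andP[/andP[_ ->] ->].
Qed.

Lemma card_roots_lt (A : idomainType) (T : finType) (W : {set T}) (y : T -> A)
    (q : {poly A}) : q != 0 -> {in W &, injective y} ->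
  (forall x, x \in W -> root q (y x)) -> (#|W| < size q)%N.
Proof.
move=> q0 yinj rt; rewrite cardE -(size_map y).
apply: max_poly_roots => //.
  by apply/allP => _ /mapP[x xW ->]; apply: rt; rewrite mem_enum in xW.
rewrite map_inj_in_uniq ?enum_uniq // => x x'; rewrite !mem_enum.
exact: yinj.
Qed.

End FiniteCounting.

Section Bezout.

Lemma size_det_le (A : idomainType) n (M : 'M[{poly A}]_n) (E : nat) :
  (forall i j, (size (M i j) <= E.+1)%N) -> (size (\det M) <= (n * E).+1)%N.
Proof.
move=> sM; rewrite /determinant; apply: (leq_trans (size_sum _ _ _)).
apply/bigmax_leqP => s _; rewrite size_Msign.
apply: (leq_trans (size_prod_leq _ _)); rewrite card_ord leq_subLR addnS ltnS.
apply: (@leq_trans (\sum_(i < n) E.+1)); first by apply: leq_sum.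
by rewrite sum_nat_const card_ord mulnS.
Qed.

Lemma divides_polyC_coef (A : idomainType) (c : A) (f : {poly A}) :
  (forall i, divides c f`_i) -> divides c%:P f.
Proof.
move=> /boolp.choice [q qE]; exists (\poly_(i < size f) q i).
apply/polyP => i; rewrite coefMC coef_poly; case: ltnP => lt_i; first exact: qE.
by rewrite mul0r nth_default.
Qed.

Variable A : idomainType.
Hypothesis uA : ufd A.
Implicit Types f g : {poly {poly A}}.

Lemma horner2_map f (X Y : A) :
  f.[Y%:P].[X] = (map_poly (horner_eval X) f).[Y].
Proof.
have := horner_map (horner_eval X) f Y%:P.
by rewrite /= /horner_eval hornerC => ->.
Qed.

Lemma slice_eq0 f (X : A) :
  map_poly (horner_eval X) f = 0 -> divides ('X - X%:P)%:P f.
Proof.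
move=> f0; apply: divides_polyC_coef => i; apply/factor_theorem.
have /(congr1 (fun p : {poly A} => p`_i)) := f0.
by rewrite coef_map coef0 /= => /eqP.
Qed.

Lemma size_slice f (X : A) : (size (map_poly (horner_eval X) f) <= size f)%N.
Proof. exact: size_poly. Qed.

(** The Sylvester matrix has at most [2 * E] rows and its entries have degree at most [E]. *)
Lemma size_resultant_le f g E : (size f <= E.+1)%N -> (size g <= E.+1)%N ->
  (polyXY.sizeY f <= E.+1)%N -> (polyXY.sizeY g <= E.+1)%N ->
  (size (resultant f g) <= (2 * E * E).+1)%N.
Proof.
move=> sf sg tf tg; apply: leq_trans (size_det_le (E := E) _) _.
  move=> i j; rewrite Sylvester_mxE; case: split => k.
    rewrite mulrb; case: ifP => _; rewrite ?size_poly0 //.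
    by apply: leq_trans tf; apply: polyXY.max_size_coefXY.
  rewrite mulrb; case: ifP => _; rewrite ?size_poly0 //.
  by apply: leq_trans tg; apply: polyXY.max_size_coefXY.
rewrite ltnS leq_mul2r mul2n -addnn; apply/orP; right; apply: leq_add.
  by case: (size g) sg.
by case: (size f) sf.
Qed.

Lemma irred_slice_neq0 f (X : A) : irred f -> (1 < size f)%N ->
  map_poly (horner_eval X) f != 0.
Proof.
move=> [_ _ firr] sf; apply/eqP => /slice_eq0 [q qE].
have sX : size ('X - X%:P) = 2 by rewrite size_XsubC.
case: (firr _ _ qE) => [/unit_size1 s1|].
  move: sf; rewrite qE mulrC size_Cmul ?s1 //.
  by rewrite -size_poly_gt0 sX.
by rewrite unit_polyC => /unit_size1; rewrite sX.
Qed.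

(** A weak form of Bezout's theorem. The abscissae are roots of the resultant in the outer variable,
    or of whichever of [f] and [g] does not involve that variable. *)
Lemma irred_common_zeros f g (E : nat) (T : finType) (zX zY : T -> A)
    (Z : {set T}) :
  irred f -> ~ divides f g ->
  (size f <= E.+1)%N -> (size g <= E.+1)%N ->
  (polyXY.sizeY f <= E.+1)%N -> (polyXY.sizeY g <= E.+1)%N ->
  injective (fun l => (zX l, zY l)) ->
  (forall l, l \in Z -> f.[(zY l)%:P].[zX l] = 0) ->
  (forall l, l \in Z -> g.[(zY l)%:P].[zX l] = 0) ->
  (#|Z| <= 2 * E * E * E)%N.
Proof.
move=> firr ndv sf sg tf tg zinj fZ gZ.
(* [r] leaves at most [2 * E * E] abscissae; [h] vanishes at the points without vanishing on a whole
   vertical line through one of them, so each abscissa has at most [E] points. *)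
suff [r [h [r0 sr rX sh]]] : exists (r : {poly A}) (h : {poly {poly A}}),
    [/\ r != 0, (size r <= (2 * E * E).+1)%N,
        forall l, l \in Z -> root r (zX l) &
        [/\ (size h <= E.+1)%N, forall l, l \in Z -> h.[(zY l)%:P].[zX l] = 0
         & forall l, l \in Z -> map_poly (horner_eval (zX l)) h != 0]].
  case: sh => sh hZ h0.
  pose s := undup [seq zX l | l <- enum Z].
  have ss : (size s <= 2 * E * E)%N.
    rewrite -ltnS; apply: leq_trans sr; apply: max_poly_roots => //.
      apply/allP => X; rewrite mem_undup => /mapP[l]; rewrite mem_enum => lZ ->.
      exact: rX.
    exact: undup_uniq.
  apply: (@leq_trans (size s * E)); last by rewrite leq_mul2r ss orbT.
  apply: (@card_fibers_le _ _ _ zX) => [l lZ|X].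
    by rewrite mem_undup; apply: map_f; rewrite mem_enum.
  rewrite mem_undup => /mapP[l]; rewrite mem_enum => lZ XE.
  rewrite -ltnS; apply: leq_trans (leq_trans (size_slice h X) sh).
  apply: (card_roots_lt (y := zY)); first by rewrite XE; apply: h0.
    move=> l1 l2; rewrite !inE => /andP[_ /eqP e1] /andP[_ /eqP e2] e.
    by apply: zinj; rewrite e1 e2 e.
  move=> l'; rewrite !inE => /andP[l'Z /eqP e1].
  by rewrite rootE -horner2_map -e1; apply/eqP/hZ.
have sizeC (c : {poly {poly A}}) : (size c <= 1)%N -> (polyXY.sizeY c <= E.+1)%N ->
    (forall l, l \in Z -> c.[(zY l)%:P].[zX l] = 0) ->
    [/\ c = (c`_0)%:P, (size (c`_0)%R <= (2 * E * E).+1)%N &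
       forall l, l \in Z -> root c`_0 (zX l)].
  move=> sc tc cZ; have cE : c = (c`_0)%:P by apply: size1_polyC.
  split=> //.
    apply: leq_trans (polyXY.max_size_coefXY _ _) (leq_trans tc _).
    rewrite ltnS; nia.
  by move=> l /cZ; rewrite cE hornerC coefC eqxx => /eqP.
have [sf1|sf1] := leqP (size f) 1.
  have [fE s0 r0] := sizeC f sf1 tf fZ.
  exists f`_0, g; split=> //.
    by apply: contraNneq (let: And3 f0 _ _ := firr in f0) => f0; rewrite fE f0.
  (* Here [f] is associated to the equation of the vertical line through the point; if [g] vanished
     on that line, [f] would divide it. *)
  split=> // l lZ; apply/eqP => /slice_eq0 [q qE]; apply: ndv.
  have /factor_theorem [k kE] := r0 l lZ.
  have fE' : f = k%:P * ('X - (zX l)%:P)%:P by rewrite -polyCM -kE.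
  have [_ _ /(_ _ _ fE')] := firr; case=> [ku|].
    exists (q * k%:P^-1); by rewrite qE fE' -mulrA (mulKr ku).
  by rewrite unit_polyC => /unit_size1; rewrite size_XsubC.
have [sg1|sg1] := leqP (size g) 1.
  have [gE s0 r0] := sizeC g sg1 tg gZ.
  exists g`_0, f; split=> //.
    by apply/eqP => g0; apply: ndv; rewrite gE g0; apply: divides0.
  by split=> // l _; apply: irred_slice_neq0.
exists (resultant f g), f; split=> //.
- rewrite resultant_eq0 -leqNgt leqNgt; apply/negP => sgcd; apply: ndv.
  exact: (irred_gcdp_divides (ufd_poly uA)).
- exact: size_resultant_le.
- move=> l lZ; have [[u v] /= [_ _ rE]] := resultant_in_ideal sf1 sg1.
  rewrite rootE -[X in X.[_]](hornerC _ ((zY l)%:P)) rE hornerD !hornerM.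
  by rewrite hornerD !hornerM fZ // gZ // !mulr0 addr0.
- by split=> // l _; apply: irred_slice_neq0.
Qed.

End Bezout.

(** * Trivariate polynomials *)

Section Trivariate.
Variable R : fieldType.
Local Notation A := {poly R}.
Local Notation S := {poly {poly {poly R}}}.
Implicit Types f g : S.
Local Notation swapXY := polyXY.swapXY.
Local Notation sizeY := polyXY.sizeY.

(* A polynomial in [t], [x], [y] has [t] innermost and [y] outermost; [tflip] makes [t]
   the outermost variable. *)
Definition tflip f := swapXY (map_poly (@swapXY R) f).

Definition degT f := size (tflip f).

(** The degree is bounded in each variable separately: this allows a full box of [D.+1 ^ 3]
    monomials, passes to divisors, and makes the restriction to a line of degree at most [3 * D]. *)
Definition tribounded (D : nat) f :=
  [&& size f <= D.+1, sizeY f <= D.+1 & degT f <= D.+1]%N.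

Lemma ufd_trivariate : ufd S.
Proof. exact/ufd_poly/ufd_poly/ufd_poly/ufd_field. Qed.

Lemma coef_tflip f i j k : (((tflip f)`_k)`_j)`_i = ((f`_j)`_i)`_k.
Proof. by rewrite /tflip polyXY.coef_swapXY coef_map polyXY.coef_swapXY. Qed.

Lemma tflip_eq0 f : (tflip f == 0) = (f == 0).
Proof.
apply/eqP/eqP => [f0|->]; last by rewrite /tflip !rmorph0.
apply/polyP => j; apply/polyP => i; apply/polyP => k.
by rewrite -coef_tflip f0 !coef0.
Qed.

Lemma tflipM f g : tflip (f * g) = tflip f * tflip g.
Proof. by rewrite /tflip rmorphM rmorphM. Qed.

Lemma degT_leP f n :
  reflect (forall i j, (size ((f`_j)%R`_i)%R <= n)%N) (degT f <= n)%N.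
Proof.
apply: (iffP idP) => [/leq_sizeP le_n i j|le_n].
  by apply/leq_sizeP => k /le_n k0; rewrite -coef_tflip k0 !coef0.
apply/leq_sizeP => k le_k; apply/polyP => j; apply/polyP => i.
by rewrite coef_tflip !coef0; have /leq_sizeP := le_n i j; apply.
Qed.

Lemma sizeY_leP (B : nzRingType) (f : {poly {poly B}}) n :
  reflect (forall j, (size (f`_j)%R <= n)%N) (sizeY f <= n)%N.
Proof.
apply: (iffP idP) => [le_n j|le_n]; first exact: leq_trans (polyXY.max_size_coefXY _ _) le_n.
by apply/bigmax_leqP => j _.
Qed.

Lemma sizeY_polyD (B : nzRingType) (f g : {poly {poly B}}) :
  (sizeY (f + g) <= maxn (sizeY f) (sizeY g))%N.
Proof.
apply/sizeY_leP => j; rewrite coefD; apply: leq_trans (size_polyD _ _) _.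
by rewrite geq_max !leq_max !polyXY.max_size_coefXY orbT.
Qed.

Lemma sizeY_polyM (B : comNzRingType) (f g : {poly {poly B}}) :
  (sizeY (f * g)%R <= (sizeY f + sizeY g).-1)%N.
Proof. by rewrite !polyXY.sizeYE rmorphM; apply: size_polyMleq. Qed.

Lemma sizeY_polyN (B : nzRingType) (f : {poly {poly B}}) : sizeY (- f) = sizeY f.
Proof. by rewrite !polyXY.sizeYE rmorphN size_polyN. Qed.

Lemma sizeM_pred (B : idomainType) (f g : {poly B}) : f != 0 -> g != 0 ->
  (size (f * g)).-1 = ((size f).-1 + (size g).-1)%N.
Proof.
move=> f0 g0; rewrite size_mul // (polySpred f0) (polySpred g0) /=; lia.
Qed.

Lemma size_mull_le (B : idomainType) (f g : {poly B}) : f * g != 0 ->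
  (size f <= size (f * g)%R)%N.
Proof.
move=> fg0; have f0 : f != 0 by apply: contraNneq fg0 => ->; rewrite mul0r.
have g0 : g != 0 by apply: contraNneq fg0 => ->; rewrite mulr0.
by rewrite size_mul // (polySpred g0) addnS leq_addr.
Qed.

Lemma tribounded_divisor D f g : g != 0 -> divides f g -> tribounded D g ->
  tribounded D f.
Proof.
move=> g0 [h]; rewrite mulrC => gE.
rewrite /tribounded /degT !polyXY.sizeYE => /and3P[b1 b2 b3].
apply/and3P; split.
- by apply: leq_trans b1; rewrite gE size_mull_le // -gE.
- apply: leq_trans b2; rewrite gE rmorphM size_mull_le // -rmorphM -gE.
  by rewrite polyXY.swapXY_eq0.
- by apply: leq_trans b3; rewrite gE tflipM size_mull_le // -tflipM -gE tflip_eq0.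
Qed.

(** Additive, and zero only on units among nonzero polynomials; so it bounds the number of
    irreducible factors. *)
Definition tridegree f := ((size f).-1 + (sizeY f).-1 + (degT f).-1)%N.

Lemma tridegreeM f g : f != 0 -> g != 0 ->
  tridegree (f * g) = (tridegree f + tridegree g)%N.
Proof.
move=> f0 g0; rewrite /tridegree /degT !polyXY.sizeYE rmorphM tflipM.
rewrite !sizeM_pred ?tflip_eq0 ?polyXY.swapXY_eq0 //.
by rewrite [X in (X + _)%N]addnACA addnACA.
Qed.

Lemma tridegree0_unit f : f != 0 -> tridegree f = 0%N -> f \is a GRing.unit.
Proof.
move=> f0 /eqP; rewrite !addn_eq0 -!andbA => /and3P[/eqP s1 /eqP s2 /eqP s3].
have pred1 n : n.-1 = 0%N -> (n <= 1)%N by case: n => [|[]].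
have fE : f = (f`_0)%:P by apply/size1_polyC/pred1.
have f00 : f`_0 = ((f`_0)`_0)%:P.
  by apply: size1_polyC; apply: leq_trans (polyXY.max_size_coefXY _ _) (pred1 _ s2).
have f000 : (f`_0)`_0 = (((f`_0)`_0)`_0)%:P.
  by apply: size1_polyC; have /degT_leP := pred1 _ s3; apply.
rewrite fE f00 f000 !unit_polyC unitfE.
by apply: contraNneq f0 => c0; rewrite fE f00 f000 c0.
Qed.

Lemma factorization g : g != 0 -> exists (u : S) (fs : seq S),
  [/\ u \is a GRing.unit, g = u * \prod_(f <- fs) f,
      forall f, f \in fs -> irred f & (size fs <= tridegree g)%N].
Proof.
move: g; apply: (ufd_ind ufd_trivariate) => [u uu|p a pirr a0].
  by exists u, [::]; rewrite big_nil mulr1.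
move=> [u [fs [uu aE firr sfs]]]; exists u, (p :: fs); split=> //.
- by rewrite big_cons {1}aE mulrCA.
- by move=> f; rewrite inE => /orP[/eqP->|/firr].
have [p0 pu _] := pirr.
rewrite tridegreeM //= -[X in (X <= _)%N]add1n leq_add // lt0n.
by apply: contraNneq pu => /(tridegree0_unit p0).
Qed.

Lemma size_horner_le (p : {poly {poly R}}) (X : {poly R}) (a D : nat) :
  (size p <= D.+1)%N -> (forall i, (size (p`_i)%R <= a.+1)%N) ->
  (size X <= 2)%N -> (size (p.[X])%R <= (a + D).+1)%N.
Proof.
move=> sp sc sX; rewrite horner_coef; apply: (leq_trans (size_sum _ _ _)).
apply/bigmax_leqP => i _; apply: (leq_trans (size_polyMleq _ _)).
have h1 := sc i; have h2 := size_poly_exp_leq X i.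
have h3 : ((size X).-1 * i <= i)%N by case: (size X) sX => [|[|[]]] //= _; rewrite ?mul0n ?mul1n.
have h4 := leq_trans (ltn_ord i) sp.
move: (size (p`_i)) (size (X ^+ i)) h1 h2 => n1 n2; move: ((size X).-1 * i)%N h3 => n3; lia.
Qed.

Lemma size_horner2_le f (X Y : {poly R}) (D : nat) : tribounded D f ->
  (size X <= 2)%N -> (size Y <= 2)%N ->
  (size (f.[Y%:P].[X])%R <= (3 * D).+1)%N.
Proof.
move=> /and3P[b1 /sizeY_leP b2 /degT_leP b3] sX sY; rewrite horner2_map.
have -> : (3 * D = D + D + D)%N by lia.
apply: size_horner_le => //; first exact: leq_trans (size_slice _ _) b1.
by move=> i; rewrite coef_map /=; apply: size_horner_le.
Qed.

End Trivariate.

(** * Surfaces contain few of the lines *)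

Section Derivations.

Definition derivation (B : comNzRingType) (d : B -> B) :=
  (forall x y, d (x + y) = d x + d y) /\
  (forall x y, d (x * y) = d x * y + x * d y).

Variables (B : comNzRingType) (d : B -> B).
Hypothesis dd : derivation d.

Lemma derivationD x y : d (x + y) = d x + d y. Proof. exact: dd.1. Qed.

Lemma derivationM x y : d (x * y) = d x * y + x * d y. Proof. exact: dd.2. Qed.

Lemma derivation0 : d 0 = 0.
Proof. by apply: (addIr (d 0)); rewrite -derivationD !add0r. Qed.

Lemma derivation1 : d 1 = 0.
Proof.
apply: (addIr (d 1)); rewrite add0r -[in RHS](mulr1 1) derivationM.
by rewrite mulr1 mul1r.
Qed.

Lemma derivationN x : d (- x) = - d x.
Proof. by apply: (addIr (d x)); rewrite -derivationD !addNr derivation0. Qed.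

Lemma derivationMn x n : d (x *+ n) = d x *+ n.
Proof.
by elim: n => [|n IHn]; rewrite ?mulr0n ?derivation0 // !mulrS derivationD IHn.
Qed.

Lemma derivation_sum I (r : seq I) P F :
  d (\sum_(i <- r | P i) F i) = \sum_(i <- r | P i) d (F i).
Proof. exact: (big_morph d derivationD derivation0). Qed.

Lemma coef_map_derivation p i : (map_poly d p)`_i = d p`_i.
Proof. exact/coef_map_id0/derivation0. Qed.

Lemma derivation_map : derivation (map_poly d : {poly B} -> {poly B}).
Proof.
split=> p q; apply/polyP => i.
  by rewrite coefD !coef_map_derivation coefD derivationD.
rewrite coefD coef_map_derivation !coefM derivation_sum -big_split /=.
by apply: eq_bigr => j _; rewrite !coef_map_derivation derivationM.
Qed.

Lemma derivation_map_polyC c : map_poly d c%:P = (d c)%:P.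
Proof.
apply/polyP => i; rewrite coef_map_derivation !coefC.
by case: ifP => _ //; apply: derivation0.
Qed.

Lemma derivation_map_polyX : map_poly d 'X = 0.
Proof.
apply/polyP => i; rewrite coef_map_derivation coefX coef0.
by case: eqP => _; [apply: derivation1 | apply: derivation0].
Qed.

Lemma horner_derivation (p : {poly B}) (b : B) :
  d p.[b] = (map_poly d p).[b] + p^`().[b] * d b.
Proof.
have [mD mM] := derivation_map.
elim/poly_ind: p => [|p c IHp].
  by rewrite deriv0 map_poly0 !horner0 mul0r addr0 derivation0.
rewrite mD mM derivation_map_polyC derivation_map_polyX mulr0 addr0.
rewrite derivD derivM derivX derivC mulr1 addr0 !hornerE derivationD derivationM IHp.
ring.
Qed.

Lemma deriv_map_derivation (p : {poly B}) :
  (map_poly d p)^`() = map_poly d p^`().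
Proof.
apply/polyP => i.
by rewrite coef_deriv !coef_map_derivation coef_deriv derivationMn.
Qed.

End Derivations.

Lemma derivation_deriv (B : comNzRingType) : derivation (@deriv B).
Proof. by split=> p q; [apply: derivD | apply: derivM]. Qed.

Lemma size_deriv_le (B : nzRingType) (p : {poly B}) : (size p^`() <= size p)%N.
Proof.
have [->|p0] := eqVneq p 0; first by rewrite deriv0.
exact: ltnW (lt_size_deriv p0).
Qed.

(** * Brackets of the vector fields tangent to the lines *)

Section VectorFieldBracket.
Variables (S : comNzRingType) (dX dY dT : S -> S) (x y t : S).
Hypotheses (derX : derivation dX) (derY : derivation dY) (derT : derivation dT).
Hypotheses (dXx : dX x = 1) (dXy : dX y = 0) (dXt : dX t = 0).
Hypotheses (dYx : dY x = 0) (dYy : dY y = 1) (dYt : dY t = 0).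
Hypothesis dTt : dT t = 1.
Hypotheses (dXY : forall f, dX (dY f) = dY (dX f))
  (dTX : forall f, dT (dX f) = dX (dT f)) (dTY : forall f, dT (dY f) = dY (dT f)).

(** Solve the equations of [l_pq] for [q] and substitute in its direction vector; multiplying by
    [1 + t^2] clears the denominators. Here [(p1, p2)] is twice the point [p]. *)
Definition rotation_field (p1 p2 f : S) : S :=
  (1 + t * t) * dT f + ((p2 - y) - t * (p1 - x)) * dX f
  + (- (p1 - x) - t * (p2 - y)) * dY f.

Definition shear_field (a b f : S) : S := a * dX f + b * dY f.

Lemma rotation_field_sub p1 p2 q1 q2 f :
  rotation_field p1 p2 f - rotation_field q1 q2 f =
  shear_field (p2 - q2 - (p1 - q1) * t) (- (p1 - q1) - (p2 - q2) * t) f.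
Proof. rewrite /rotation_field /shear_field; ring. Qed.

(* The two fields commute up to a shear in the orthogonal direction. *)
Lemma rotation_shear_bracket p1 p2 u1 u2 f :
  dX p1 = 0 -> dX p2 = 0 -> dY p1 = 0 -> dY p2 = 0 ->
  dX u1 = 0 -> dX u2 = 0 -> dY u1 = 0 -> dY u2 = 0 -> dT u1 = 0 -> dT u2 = 0 ->
  let a := u2 - u1 * t in let b := - u1 - u2 * t in
  shear_field a b (rotation_field p1 p2 f)
    - rotation_field p1 p2 (shear_field a b f) = shear_field (- 2 * b) (2 * a) f.
Proof.
move=> Xp1 Xp2 Yp1 Yp2 Xu1 Xu2 Yu1 Yu2 Tu1 Tu2 a b.
have [xD xM] := derX; have [yD yM] := derY; have [tD tM] := derT.
have xN := derivationN derX; have yN := derivationN derY; have tN := derivationN derT.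
have x1 := derivation1 derX; have y1 := derivation1 derY.
have Xa : dX a = 0 by rewrite /a xD xN xM Xu2 Xu1 dXt; ring.
have Ya : dY a = 0 by rewrite /a yD yN yM Yu2 Yu1 dYt; ring.
have Xb : dX b = 0 by rewrite /b xD !xN xM Xu2 Xu1 dXt; ring.
have Yb : dY b = 0 by rewrite /b yD !yN yM Yu2 Yu1 dYt; ring.
have Ta : dT a = - u1 by rewrite /a tD tN tM Tu2 Tu1 dTt; ring.
have Tb : dT b = - u2 by rewrite /b tD !tN tM Tu2 Tu1 dTt; ring.
have aE : a = u2 - u1 * t by [].
have bE : b = - u1 - u2 * t by [].
clearbody a b; rewrite /shear_field /rotation_field.
rewrite !(tD, tM) Ta Tb !dTX !dTY.
rewrite !(xD, yD, xM, yM) Xa Xb Ya Yb !xN !yN.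
rewrite !(xD, yD, xM, yM) !xN !yN Xp1 Xp2 Yp1 Yp2 dXx dXy dXt dYx dYy dYt x1 y1 !dXY.
rewrite aE bE; ring.
Qed.

Lemma rotation_field0 p1 p2 : rotation_field p1 p2 0 = 0.
Proof.
rewrite /rotation_field (derivation0 derX) (derivation0 derY) (derivation0 derT).
by rewrite !mulr0 !addr0.
Qed.

Lemma shear_fieldM a b e f :
  shear_field a b (e * f) = shear_field a b e * f + e * shear_field a b f.
Proof. rewrite /shear_field derX.2 derY.2; ring. Qed.

Lemma orthogonal_shears a b f : shear_field a b f = 0 ->
  shear_field (- 2 * b) (2 * a) f = 0 ->
  2 * (a * a + b * b) * dX f = 0 /\ 2 * (a * a + b * b) * dY f = 0.
Proof.
rewrite /shear_field => h1 h2; split.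
  transitivity (2 * a * (a * dX f + b * dY f) - b * (- 2 * b * dX f + 2 * a * dY f)).
    by ring.
  by rewrite h1 h2 !mulr0 subr0.
transitivity (2 * b * (a * dX f + b * dY f) + a * (- 2 * b * dX f + 2 * a * dY f)).
  by ring.
by rewrite h1 h2 !mulr0 addr0.
Qed.

(** Applied to the sizes in [x] and in [y], those which [irred_common_zeros] asks for over R[t]; [t]
    counts as a constant. *)
Lemma rotation_field_size (s : S -> nat) (p1 p2 f : S) (n : nat) :
  (forall g h, s (g + h)%R <= maxn (s g) (s h))%N ->
  (forall g h, s (g * h)%R <= (s g + s h).-1)%N -> (forall g, s (- g) = s g) ->
  (s 1%R <= 1)%N -> (s t <= 1)%N -> (s x <= 2)%N -> (s y <= 2)%N ->
  (s p1 <= 1)%N -> (s p2 <= 1)%N ->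
  (s (dX f) <= n.+1)%N -> (s (dY f) <= n.+1)%N -> (s (dT f) <= n.+1)%N ->
  (s (rotation_field p1 p2 f) <= n.+2)%N.
Proof.
move=> sD sM sN s1 st sx sy sp1 sp2 sX sY sT.
have D m g h : (s g <= m)%N -> (s h <= m)%N -> (s (g + h)%R <= m)%N.
  by move=> g1 h1; apply: leq_trans (sD _ _) _; rewrite geq_max g1.
have M m g h k : (s g <= m.+1)%N -> (s h <= k.+1)%N -> (s (g * h)%R <= (m + k).+1)%N.
  by move=> g1 h1; apply: leq_trans (sM _ _) _; lia.
have W g : (s g <= 1)%N -> (s g <= 2)%N by move=> /leq_trans ->.
apply: (D); first apply: (D).
- by apply: leq_trans (M 0 _ _ n _ sT) _ => //; apply: (D) => //; apply: (M 0 _ _ 0).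
- apply: leq_trans (M 1 _ _ n _ sX) _ => //; apply: (D); rewrite ?sN.
    by apply: (D); rewrite ?sN //; apply: (W).
  by apply: (M 0 _ _ 1) => //; apply: (D); rewrite ?sN //; apply: (W).
- apply: leq_trans (M 1 _ _ n _ sY) _ => //; apply: (D); rewrite ?sN.
    by apply: (D); rewrite ?sN //; apply: (W).
  by apply: (M 0 _ _ 1) => //; apply: (D); rewrite ?sN //; apply: (W).
Qed.

End VectorFieldBracket.

Section RigidMotionLines.
Variable R : realFieldType.
Local Notation A := {poly R}.
Local Notation S := {poly {poly {poly R}}}.
Implicit Types (f : S) (p q : R * R).

Definition dY f : S := f^`().
Definition dX f : S := map_poly (@deriv A) f.
Definition dT f : S := map_poly (map_poly (@deriv R)) f.

Let cst (a : A) : S := a%:P%:P.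
Let num (r : R) : S := r%:P%:P%:P.
Let tvar : S := 'X%:P%:P.
Let xvar : S := 'X%:P.
Let yvar : S := 'X.

Lemma derivation_dY : derivation dY. Proof. exact: derivation_deriv. Qed.
Lemma derivation_dX : derivation dX.
Proof. exact/derivation_map/derivation_deriv. Qed.
Lemma derivation_dT : derivation dT.
Proof. exact/derivation_map/derivation_map/derivation_deriv. Qed.

Lemma dX_cst a : dX (cst a) = 0.
Proof.
by rewrite /dX (derivation_map_polyC (derivation_deriv _)) derivC.
Qed.
Lemma dY_cst a : dY (cst a) = 0. Proof. exact: derivC. Qed.
Lemma dT_cst a : dT (cst a) = cst a^`().
Proof.
rewrite /dT (derivation_map_polyC (derivation_map (derivation_deriv _))).
by rewrite (derivation_map_polyC (derivation_deriv _)).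
Qed.
Lemma dX_x : dX xvar = 1.
Proof. by rewrite /dX (derivation_map_polyC (derivation_deriv _)) derivX. Qed.
Lemma dY_x : dY xvar = 0. Proof. exact: derivC. Qed.
Lemma dX_y : dX yvar = 0.
Proof. exact/derivation_map_polyX/derivation_deriv. Qed.
Lemma dY_y : dY yvar = 1. Proof. exact: derivX. Qed.

Lemma dT_t : dT tvar = 1.
Proof. by apply: etrans (dT_cst 'X) _; rewrite derivX /cst !polyC1. Qed.

Lemma dX_dY f : dX (dY f) = dY (dX f).
Proof. by rewrite /dY deriv_map_derivation //; apply: derivation_deriv. Qed.
Lemma dT_dY f : dT (dY f) = dY (dT f).
Proof.
by rewrite /dY deriv_map_derivation //; apply/derivation_map/derivation_deriv.
Qed.
Lemma dT_dX f : dT (dX f) = dX (dT f).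
Proof.
have h1 := derivation_deriv A; have h2 := derivation_map (derivation_deriv R).
apply/polyP => i; rewrite !coef_map_derivation //.
by rewrite deriv_map_derivation //; apply: derivation_deriv.
Qed.

(* The line [l_pq] parametrizes the rotations taking [p] to [q]; its parameter is the
   cotangent of half the angle, and its first two coordinates are twice the centre. *)
Definition line_x (p q : R * R) : A := (p.1 + q.1)%:P + (p.2 - q.2)%:P * 'X.
Definition line_y (p q : R * R) : A := (p.2 + q.2)%:P - (p.1 - q.1)%:P * 'X.

Definition on_line f p q : A := f.[(line_y p q)%:P].[line_x p q].

(* The lines [l_pq] with [p] fixed are the integral curves of this vector field, up to the
   time change [1 + t^2]. *)
Definition row_field p : S -> S :=
  rotation_field dX dY dT xvar yvar tvar (num (2 * p.1)) (num (2 * p.2)).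

Lemma on_lineD f g p q : on_line (f + g) p q = on_line f p q + on_line g p q.
Proof. by rewrite /on_line !hornerD. Qed.
Lemma on_lineM f g p q : on_line (f * g) p q = on_line f p q * on_line g p q.
Proof. by rewrite /on_line !hornerM. Qed.

Lemma deriv_on_line f p q :
  (on_line f p q)^`() = on_line (dT f) p q + (p.2 - q.2)%:P * on_line (dX f) p q
    - (p.1 - q.1)%:P * on_line (dY f) p q.
Proof.
have d1 := derivation_deriv R; have d2 := derivation_deriv A.
rewrite /on_line (horner_derivation d1) (horner_derivation (derivation_map d1)).
rewrite (horner_derivation d2) (derivation_map_polyC d1) derivC mulr0 addr0.
have -> : (line_x p q)^`() = (p.2 - q.2)%:P.
  by rewrite /line_x derivD derivM !derivC derivX mul0r !add0r mulr1.
have -> : (line_y p q)^`() = - (p.1 - q.1)%:P.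
  by rewrite /line_y derivB derivM !derivC derivX mul0r !add0r mulr1.
rewrite hornerD hornerM hornerC /dT /dX /dY; ring.
Qed.

Lemma on_line_cst a p q : on_line (cst a) p q = a.
Proof. by rewrite /on_line !hornerC. Qed.

Lemma on_line_row_field f p q :
  on_line (row_field p f) p q = (1 + 'X ^+ 2) * (on_line f p q)^`().
Proof.
rewrite deriv_on_line /row_field /rotation_field !on_lineD !on_lineM.
set fx := (_ - yvar - _); set fy := (- (_ - xvar) - _).
have -> : on_line (1 + tvar * tvar) p q = 1 + 'X ^+ 2.
  by rewrite /on_line /tvar !hornerE /= expr2.
have -> : on_line fx p q = (1 + 'X ^+ 2) * (p.2 - q.2)%:P.
  rewrite /on_line /fx /tvar /num /xvar /yvar !hornerE /= /line_x /line_y.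
  rewrite !polyCB !polyCD !polyCM; ring.
have -> : on_line fy p q = - (1 + 'X ^+ 2) * (p.1 - q.1)%:P.
  rewrite /on_line /fy /tvar /num /xvar /yvar !hornerE /= /line_x /line_y.
  rewrite !polyCB !polyCD !polyCM; ring.
ring.
Qed.

(** A shear does not raise the degree in [y], so the quotient [e] is free of [y]. In the top
    coefficient in [y] only the derivative in [x] survives, and it has smaller degree in [x] than
    the coefficient that should divide it. *)
Lemma shear_divisible_eq0 (a b : A) f :
  divides f (shear_field dX dY (cst a) (cst b) f) ->
  shear_field dX dY (cst a) (cst b) f = 0.
Proof.
move=> [e E]; rewrite E; apply/eqP; apply/negPn/negP => ef0.
have f0 : f != 0 by apply: contraNneq ef0 => ->; rewrite mulr0.
have e0 : e != 0 by apply: contraNneq ef0 => ->; rewrite mul0r.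
have sle : (size (e * f)%R <= size f)%N.
  rewrite -E /shear_field /cst !mul_polyC; apply: leq_trans (size_polyD _ _) _.
  rewrite geq_max; apply/andP; split; apply: leq_trans (size_scale_leq _ _) _.
    exact: size_poly.
  by apply: leq_trans (size_deriv_le _).
have eE : e = (e`_0)%:P.
  apply: size1_polyC; move: sle; rewrite size_mul // (polySpred f0).
  by rewrite addnS /= -[X in (_ <= X)%N]add1n -[X in (_ <= X)%N]addn1; lia.
pose m := (size f).-1; have L0 : f`_m != 0 by rewrite -lead_coefE lead_coef_eq0.
have e00 : e`_0 != 0 by apply: contraNneq e0 => h; rewrite eE h.
have /(congr1 (fun g : S => g`_m)) := E.
rewrite /shear_field /cst eE coefD !coefCM coef_deriv.
have -> : f`_m.+1 = 0 by rewrite nth_default // /m -polySpred.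
rewrite mul0rn mulr0 addr0 (coef_map_derivation (derivation_deriv _)) => E2.
have := lt_size_deriv L0; rewrite ltnNge => /negP; apply.
have : (size (e`_0 * f`_m)%R <= size (f`_m)^`())%N.
  by rewrite -E2 mul_polyC; apply: size_scale_leq.
by apply: leq_trans; rewrite mulrC size_mull_le // mulf_neq0.
Qed.

Lemma line_inj p q p' q' : line_x p q = line_x p' q' ->
  line_y p q = line_y p' q' -> (p, q) = (p', q').
Proof.
move=> Ex Ey.
have cx i := congr1 (fun g : A => g`_i) Ex.
have cy i := congr1 (fun g : A => g`_i) Ey.
move: (cx 0%N) (cx 1%N) (cy 0%N) (cy 1%N).
rewrite /line_x /line_y !(coefD, coefB, coefN, coefCM, coefC, coefX) /=.
rewrite !(mulr0, mulr1, addr0, add0r, oppr0).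
case: p q p' q' {cx cy Ex Ey} => [p1 p2] [q1 q2] [p1' p2'] [q1' q2'] /= h1 h2 h3 h4.
have -> : p1 = p1' by lra.
have -> : p2 = p2' by lra.
have -> : q1 = q1' by lra.
by have -> : q2 = q2' by lra.
Qed.

(** The bound of [irred_common_zeros] in degree [D.+1], as a row field may raise the degrees in [x]
    and [y] by one. *)
Definition common_zeros_bound (D : nat) := (2 * D.+1 * D.+1 * D.+1)%N.

(** Up to [1 + t^2], the row field differentiates along the lines of the row, so [row_field p f]
    vanishes on those lying in the surface; there are too many of them unless [f] divides it. *)
Lemma heavy_row_divides (D : nat) f p (Q : finType) (pos : Q -> R * R)
    (Z : {set Q}) : irred f -> (size f <= D.+1)%N ->
  (polyXY.sizeY f <= D.+1)%N -> injective pos ->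
  (forall q : Q, q \in Z -> on_line f p (pos q) = 0) ->
  (common_zeros_bound D < #|Z|)%N -> divides f (row_field p f).
Proof.
move=> firr sf tf posI fZ; apply: contraPP => ndv; apply/negP; rewrite -leqNgt.
have uA : ufd A by exact/ufd_poly/ufd_field.
apply: (irred_common_zeros (E := D.+1) (zX := fun q : Q => line_x p (pos q))
  (zY := fun q : Q => line_y p (pos q)) uA firr ndv) => //.
- exact: leq_trans sf _.
- apply: (rotation_field_size (s := fun g : S => size g)) => //.
  + by move=> g h; apply: size_polyD.
  + by move=> g h; apply: size_polyMleq.
  + by move=> g; rewrite size_polyN.
  + by rewrite size_poly1.
  + exact: size_polyC_leq1.
  + by apply: leq_trans (size_polyC_leq1 _) _.
  + by rewrite size_polyX.
  + exact: size_polyC_leq1.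
  + exact: size_polyC_leq1.
  + by apply: leq_trans (size_poly _ _) sf.
  + by apply: leq_trans (size_deriv_le _) sf.
  + by apply: leq_trans (size_poly _ _) sf.
- exact: leq_trans tf _.
- have zle := sizeY_leP _ _ tf.
  apply: (rotation_field_size (s := fun g : S => polyXY.sizeY g)) => //.
  + exact: sizeY_polyD.
  + exact: sizeY_polyM.
  + exact: sizeY_polyN.
  + by rewrite polyXY.sizeYE rmorph1 size_poly1.
  + apply/sizeY_leP => j; rewrite coefC; case: ifP; rewrite ?size_poly0 // => _.
    exact: size_polyC_leq1.
  + apply/sizeY_leP => j; rewrite coefC; case: ifP; rewrite ?size_poly0 // => _.
    by rewrite size_polyX.
  + apply/sizeY_leP => j; rewrite coefX; case: eqP; rewrite ?size_poly0 // => _.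
    by rewrite size_poly1.
  + apply/sizeY_leP => j; rewrite coefC; case: ifP; rewrite ?size_poly0 // => _.
    exact: size_polyC_leq1.
  + apply/sizeY_leP => j; rewrite coefC; case: ifP; rewrite ?size_poly0 // => _.
    exact: size_polyC_leq1.
  + apply/sizeY_leP => j; rewrite (coef_map_derivation (derivation_deriv _)).
    by apply: leq_trans (size_deriv_le _) (zle _).
  + apply/sizeY_leP => j; rewrite coef_deriv -scaler_nat.
    by apply: leq_trans (size_scale_leq _ _) (zle _).
  + apply/sizeY_leP => j.
    rewrite (coef_map_derivation (derivation_map (derivation_deriv _))).
    by apply: leq_trans (size_poly _ _) (zle _).
- by move=> q q' [/line_inj h /h [/posI]].
- move=> q /fZ h.
  by have := on_line_row_field f p (pos q); rewrite h deriv0 mulr0.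
Qed.

(* If [f] divides its images under two row fields, then the difference of the two fields and
   the bracket of this difference with either field are independent shears which, for
   degree reasons, annihilate [f]; so [f] depends on [t] only. *)
Lemma two_row_fields (f : S) p p' : p != p' ->
  divides f (row_field p f) -> divides f (row_field p' f) ->
  exists c : A, f = cst c.
Proof.
move=> pp' dp dp'.
have [u1 u1E] : exists u1 : R, u1 = 2 * (p.1 - p'.1) by eexists.
have [u2 u2E] : exists u2 : R, u2 = 2 * (p.2 - p'.2) by eexists.
pose a : A := u2%:P - u1%:P * 'X; pose b : A := - u1%:P - u2%:P * 'X.
have cB (c d : A) : cst (c - d) = cst c - cst d by rewrite /cst !polyCB.
have cM (c d : A) : cst (c * d) = cst c * cst d by rewrite /cst !polyCM.
have cN (c : A) : cst (- c) = - cst c by rewrite /cst !polyCN.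
have aE : cst a = num u2 - num u1 * tvar by rewrite /a cB cM.
have bE : cst b = - num u1 - num u2 * tvar by rewrite /b cB cM cN.
have c2 : cst 2 = 2 by rewrite /cst !polyC_natr.
have nB r1 r2 : num (2 * (r1 - r2)) = num (2 * r1) - num (2 * r2).
  by rewrite /num mulrBr !polyCB.
have U0 : shear_field dX dY (cst a) (cst b) f = 0.
  apply: shear_divisible_eq0; rewrite aE bE u1E u2E !nB.
  rewrite -(rotation_field_sub dX dY dT xvar yvar tvar).
  by apply: dividesD => //; apply: dividesN.
have W0 : shear_field dX dY (cst (- 2 * b)) (cst (2 * a)) f = 0.
  apply: shear_divisible_eq0.
  have -> : cst (- 2 * b) = - 2 * cst b by rewrite cM cN c2.
  have -> : cst (2 * a) = 2 * cst a by rewrite cM c2.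
  rewrite aE bE.
  have xn r : dX (num r) = 0 by apply: dX_cst.
  have yn r : dY (num r) = 0 by apply: dY_cst.
  have tn r : dT (num r) = 0 by rewrite dT_cst derivC /cst.
  rewrite -(rotation_shear_bracket derivation_dX derivation_dY derivation_dT
    dX_x dX_y (dX_cst _) dY_x dY_y (dY_cst _) dT_t dX_dY dT_dX dT_dY f
    (xn (2 * p.1)) (xn (2 * p.2)) (yn _) (yn _) (xn u1) (xn u2) (yn u1) (yn u2)
    (tn u1) (tn u2)).
  (* Since the shear annihilates [f], the bracket reduces to the shear of [row_field p f = e * f],
     again a multiple of [f]. *)
  rewrite -aE -bE U0.
  rewrite (rotation_field0 _ _ _ derivation_dX derivation_dY derivation_dT) subr0.
  case: dp => e; rewrite /row_field => ->.
  rewrite (shear_fieldM derivation_dX derivation_dY) U0 mulr0 addr0.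
  by eexists.
have n0 : cst (2 * (a * a + b * b)) != 0.
  rewrite /cst !polyC_eq0; apply: contraNneq pp' => /(congr1 (fun g : A => g.[0])).
  rewrite /a /b !hornerE /= => h.
  have h1 : u1 = 0 by nra.
  have h2 : u2 = 0 by nra.
  apply/eqP; case: (p) (p') u1E u2E => [x1 x2] [y1 y2] /=.
  by rewrite h1 h2 => e1 e2; congr (_, _); lra.
have cD (c d : A) : cst (c + d) = cst c + cst d.
  exact: etrans (congr1 polyC (polyCD c d)) (polyCD _ _).
have [eX eY] : 2 * (cst a * cst a + cst b * cst b) * dX f = 0 /\
               2 * (cst a * cst a + cst b * cst b) * dY f = 0.
  by apply: orthogonal_shears U0 _; rewrite -c2 -cN -!cM.
have nE : cst (2 * (a * a + b * b)) = 2 * (cst a * cst a + cst b * cst b).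
  by rewrite cM c2 cD !cM.
have fX : dX f = 0 by apply: (mulfI n0); rewrite mulr0 nE.
have fY : dY f = 0 by apply: (mulfI n0); rewrite mulr0 nE.
have d0 (B : idomainType) (g : {poly B}) : (forall n, n.+1%:R != 0 :> B) ->
    g^`() = 0 -> g = (g`_0)%:P.
  move=> ch g0; apply/polyP => -[|i]; rewrite coefC //=.
  have /(congr1 (fun h : {poly B} => h`_i)) := g0.
  rewrite coef_deriv coef0 -mulr_natr => /eqP.
  by rewrite mulf_eq0 (negPf (ch i)) orbF => /eqP.
have ch0 n : n.+1%:R != 0 :> A by rewrite -polyC_natr polyC_eq0 pnatr_eq0.
have fE : f = (f`_0)%:P.
  by apply: d0 fY => n; rewrite -polyC_natr polyC_eq0.
have f0E : f`_0 = ((f`_0)`_0)%:P.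
  apply: d0 => //; have /(congr1 (fun g : S => g`_0)) := fX.
  by rewrite (coef_map_derivation (derivation_deriv _)) coef0.
by exists (f`_0)`_0; rewrite /cst -f0E -fE.
Qed.

(** By [two_row_fields] at most one row has more than [B] lines; it contributes at most [#|P|],
    every other row at most [B]. *)
Lemma surface_lines_le (D : nat) f (P : finType) (pos : P -> R * R) :
  irred f -> (size f <= D.+1)%N -> (polyXY.sizeY f <= D.+1)%N -> injective pos ->
  (#|[set l : P * P | on_line f (pos l.1) (pos l.2) == 0%R]|
     <= (common_zeros_bound D).+1 * #|P|)%N.
Proof.
move=> firr sf tf posI; set Z := [set l | _]; set B := common_zeros_bound D.
pose row x := [set y | on_line f (pos x) (pos y) == 0].
have ZE : #|Z| = (\sum_x #|row x|)%N.
  rewrite -sum1_card (eq_bigl (fun l : P * P => true && (l.2 \in row l.1))); last first.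
    by move=> l; rewrite /Z /row !inE.
  rewrite -(pair_big_dep predT (fun x y => y \in row x) (fun _ _ => 1%N)) /=.
  by apply: eq_bigr => x _; rewrite sum1_card.
have rowN x : (#|row x| <= #|P|)%N by apply: max_card.
have dv x : (B < #|row x|)%N -> divides f (row_field (pos x) f).
  by move=> hv; apply: (heavy_row_divides firr sf tf posI _ hv) => y; rewrite inE => /eqP.
have [[x0 heavy]|light] := pselect (exists x, (B < #|row x|)%N).
  have light x : x != x0 -> (#|row x| <= B)%N.
    move=> xx0; rewrite leqNgt; apply/negP => heavy'.
    have [|c fE] := two_row_fields _ (dv _ heavy') (dv _ heavy).
      by apply: contraNneq xx0 => /posI ->.
    have [y] : exists y, y \in row x0.
      by apply/set0Pn; rewrite -cards_eq0 -lt0n; apply: leq_trans heavy.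
    rewrite inE fE on_line_cst => /eqP c0; case: firr => /eqP f0 _ _; apply: f0.
    by rewrite fE c0 /cst.
  rewrite ZE (bigD1 x0) //= mulSn leq_add // mulnC.
  apply: leq_trans (_ : \sum_(x | x != x0) B <= _)%N.
    by apply: leq_sum => x /light.
  by rewrite sum_nat_const leq_mul2r max_card orbT.
rewrite ZE; apply: leq_trans (_ : \sum_(x : P) B <= _)%N.
  apply: leq_sum => x _; rewrite leqNgt; apply/negP => h; apply: light; by exists x.
by rewrite sum_nat_const mulSn mulnC leq_addl.
Qed.

End RigidMotionLines.

(** * A weak ham sandwich theorem *)

Section WeakHamSandwich.
Variables (R : realFieldType) (n : nat).
Implicit Types (g : 'cV[R]_n) (v : 'rV[R]_n) (N : 'cV[R]_n -> Prop).

Definition pairing v g : R := (v *m g) ord0 ord0.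

Lemma pairingB v (a b : R) g h :
  pairing v (a *: g - b *: h) = a * pairing v g - b * pairing v h.
Proof. by rewrite /pairing mulmxBr -!scalemxAr !mxE. Qed.

Definition subspace N := forall (a b : R) g h, N g -> N h -> N (a *: g - b *: h).

(* [g] spans the last nonzero step of the filtration of [N] by the number of leading zero
   coordinates, which makes it unique up to scaling; [k] is its first nonzero coordinate. *)
Definition echelon_max N g (k : 'I_n) :=
  [/\ N g, forall i : 'I_n, (i < k)%N -> g i ord0 = 0, g k ord0 != 0
    & forall h, N h -> (forall i : 'I_n, (i <= k)%N -> h i ord0 = 0) -> h = 0].

Lemma echelon_max_exists N : (exists2 g, N g & g != 0) ->
  exists g k, echelon_max N g k.
Proof.
move=> [g0 Ng0 g00].
pose Q k := `[< exists g, [/\ N g, g != 0 & forall i : 'I_n, (i < k)%N -> g i ord0 = 0] >].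
have Q0 : exists k, Q k by exists 0%N; apply/asboolP; exists g0.
have Qn k : Q k -> (k <= n)%N.
  move=> /asboolP [g [_ gn0 gz]]; rewrite leqNgt; apply: contraNN gn0 => nk.
  apply/eqP/matrixP => i j; rewrite (ord1 j) mxE; apply: gz.
  exact: leq_trans (ltn_ord i) (ltnW nk).
case: (ex_maxnP Q0 Qn) => k /asboolP [g [Ng gn0 gz]] kmax.
have ltk : (k < n)%N.
  rewrite ltnNge; apply: contraNN gn0 => nk.
  apply/eqP/matrixP => i j; rewrite (ord1 j) mxE; apply: gz.
  exact: leq_trans (ltn_ord i) nk.
have stop h : N h -> (forall i : 'I_n, (i <= k)%N -> h i ord0 = 0) -> h = 0.
  move=> Nh hz; apply/eqP/negPn/negP => hn0.
  have /kmax : Q k.+1 by apply/asboolP; exists h.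
  by rewrite ltnn.
exists g, (Ordinal ltk); split=> //.
apply: contraNneq gn0 => gk; apply/eqP/stop => // i.
by rewrite leq_eqVlt => /orP[/eqP ik|/gz//]; rewrite -gk; congr (g _ _); apply: val_inj.
Qed.

Lemma echelon_max_unique N g k h : subspace N -> echelon_max N g k -> N h ->
  (forall i : 'I_n, (i < k)%N -> h i ord0 = 0) -> exists c, h = c *: g.
Proof.
move=> Nsub [Ng gz gk gmax] Nh hz; exists (h k ord0 / g k ord0).
have := Nsub 1 (h k ord0 / g k ord0) _ _ Nh Ng; rewrite scale1r => Nd.
apply/eqP; rewrite -subr_eq0; apply/eqP/(gmax _ Nd) => i.
rewrite !mxE leq_eqVlt => /orP[/eqP/val_inj->|ik].
  by rewrite divfK // subrr.
by rewrite (hz i ik) (gz i ik) mulr0 subrr.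
Qed.

(** The combination [h] of [g1] and [g3] killed by [v2] has at least [k2] leading zeros, so it is a
    multiple [c *: g2]. Evaluating it at [v1] and [v3] writes [c^2] times the second product as
    minus the product of the two others. *)
Lemma not_three_same_signs_aux N v1 v2 v3 g1 g2 g3 (k1 k2 k3 : 'I_n) :
  subspace N ->
  echelon_max (fun g => N g /\ pairing v1 g = 0) g1 k1 ->
  echelon_max (fun g => N g /\ pairing v2 g = 0) g2 k2 ->
  echelon_max (fun g => N g /\ pairing v3 g = 0) g3 k3 ->
  (k2 <= k1)%N -> (k2 <= k3)%N ->
  ~ [/\ 0 < pairing v2 g1 * pairing v3 g1, 0 < pairing v3 g2 * pairing v1 g2
      & 0 < pairing v1 g3 * pairing v2 g3].
Proof.
move=> Nsub m1 m2 m3 k21 k23 [p1 p2 p3].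
have [[N1 e1] z1 _ _] := m1; have [[N3 e3] z3 _ _] := m3.
have Nsub2 : subspace (fun g => N g /\ pairing v2 g = 0).
  move=> a b g h [Ng eg] [Nh eh]; split; first exact: Nsub.
  by rewrite pairingB eg eh !mulr0 subrr.
pose h := pairing v2 g3 *: g1 - pairing v2 g1 *: g3.
have Nh : N h /\ pairing v2 h = 0.
  by split; [exact: Nsub | rewrite pairingB mulrC subrr].
have hz (i : 'I_n) : (i < k2)%N -> h i ord0 = 0.
  by move=> ik; rewrite !mxE z1 ?z3 ?mulr0 ?subrr // (leq_trans ik).
have [c hE] := echelon_max_unique Nsub2 m2 Nh hz.
have c1 := congr1 (pairing v1) hE; have c3 := congr1 (pairing v3) hE.
have pZ v a g : pairing v (a *: g) = a * pairing v g by rewrite /pairing -scalemxAr mxE.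
move: c1 c3; rewrite /h !pairingB !pZ e1 e3 !mulr0 sub0r subr0 => c1 c3.
have E : c * pairing v1 g2 * (c * pairing v3 g2) =
   - (pairing v2 g1 * pairing v3 g1) * (pairing v1 g3 * pairing v2 g3).
  by rewrite -c1 -c3; ring.
have h2 : 0 <= c * pairing v1 g2 * (c * pairing v3 g2).
  have -> : c * pairing v1 g2 * (c * pairing v3 g2) = c ^+ 2 * (pairing v3 g2 * pairing v1 g2).
    by ring.
  by rewrite mulr_ge0 ?sqr_ge0 // ltW.
have := mulr_gt0 p1 p3; move: h2; rewrite E mulNr oppr_ge0 => h2 h3.
by have := lt_le_trans h3 h2; rewrite ltxx.
Qed.

Lemma not_three_same_signs N v1 v2 v3 g1 g2 g3 (k1 k2 k3 : 'I_n) :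
  subspace N ->
  echelon_max (fun g => N g /\ pairing v1 g = 0) g1 k1 ->
  echelon_max (fun g => N g /\ pairing v2 g = 0) g2 k2 ->
  echelon_max (fun g => N g /\ pairing v3 g = 0) g3 k3 ->
  ~ [/\ 0 < pairing v2 g1 * pairing v3 g1, 0 < pairing v3 g2 * pairing v1 g2
      & 0 < pairing v1 g3 * pairing v2 g3].
Proof.
move=> Nsub m1 m2 m3 [p1 p2 p3].
have [h12|h12] := leqP k1 k2.
  have [h13|h13] := leqP k1 k3.
    exact: (not_three_same_signs_aux Nsub m3 m1 m2 h13 h12 (And3 p3 p1 p2)).
  exact: (not_three_same_signs_aux Nsub m2 m3 m1 (ltnW (leq_trans h13 h12)) (ltnW h13)
    (And3 p2 p3 p1)).
have [h23|h23] := leqP k2 k3.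
  exact: (not_three_same_signs_aux Nsub m1 m2 m3 (ltnW h12) h23 (And3 p1 p2 p3)).
exact: (not_three_same_signs_aux Nsub m2 m3 m1 (ltnW h23) (ltnW (ltn_trans h23 h12))
  (And3 p2 p3 p1)).
Qed.

Section Averaging.
Variables (Pt J : finType) (phi : Pt -> 'rV[R]_n) (B : {set J}) (A : J -> {set Pt}).

Let annihilates (t : {ffun J -> Pt}) g := forall j, j \in B -> pairing (phi (t j)) g = 0.

Lemma annihilator_exists (t : {ffun J -> Pt}) : (#|B| < n)%N ->
  exists2 g, annihilates t g & g != 0.
Proof.
move=> Bn; pose M : 'M[R]_(#|B|, n) := \matrix_(i, j) phi (t (enum_val i)) ord0 j.
have : cokermx M != 0.
  by rewrite -mxrank_eq0 mxrank_coker -lt0n subn_gt0 (leq_ltn_trans (rank_leq_row _)).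
case/matrix0Pn => i [j ij0]; exists (col j (cokermx M)).
  move=> k kB; have /matrixP/(_ (enum_rank_in kB k) j) := mulmx_coker M.
  rewrite !mxE => <-; rewrite /pairing mxE; apply: eq_bigr => l _.
  by rewrite !mxE enum_rankK_in.
by apply: contraNneq ij0 => /matrixP/(_ i ord0); rewrite !mxE => ->.
Qed.

Let transversal : {set {ffun J -> Pt}} := [set t : {ffun J -> Pt} | [forall j in B, t j \in A j]].

Let upd (t : {ffun J -> Pt}) j a : {ffun J -> Pt} := [ffun i => if i == j then a else t i].

(** The average over [(t, (a, b))] is invariant under cyclic permutation of the points [t j], [a],
    [b] of [A j], and at most two of the three permuted configurations are bad. *)
Lemma average_same_sign (G : {ffun J -> Pt} -> 'cV[R]_n) (K : {ffun J -> Pt} -> 'I_n)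
    (j : J) : (forall t, echelon_max (annihilates t) (G t) (K t)) -> j \in B ->
  (3 * \sum_(t in transversal)
       #|[set ab in setX (A j) (A j) |
           (0 < pairing (phi ab.1) (G t) * pairing (phi ab.2) (G t))%R]|
   <= 2 * \sum_(t in transversal) #|A j| ^ 2)%N.
Proof.
move=> GK jB.
pose D := [set w : {ffun J -> Pt} * (Pt * Pt) |
   [&& w.1 \in transversal, w.2.1 \in A j & w.2.2 \in A j]].
pose bad (w : {ffun J -> Pt} * (Pt * Pt)) :=
  (0 < pairing (phi w.2.1) (G w.1) * pairing (phi w.2.2) (G w.1))%R.
(* The cyclic permutation: [a] becomes the chosen point and [t j] joins [b] in the pair. *)
pose sg (w : {ffun J -> Pt} * (Pt * Pt)) := (upd w.1 j w.2.1, (w.2.2, w.1 j)).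
have transE t a : a \in A j -> (upd t j a \in transversal) =
    [forall i in B, (i != j) ==> (t i \in A i)].
  move=> aA; rewrite inE; apply: eq_forallb => i; rewrite ffunE.
  by case: eqP => [->|_]; rewrite ?aA ?implybT.
have trans_split t : (t \in transversal) =
    (t j \in A j) && [forall i in B, (i != j) ==> (t i \in A i)].
  rewrite inE; apply/forall_inP/andP => [h|[h1 /forall_inP h2] i iB].
    by split; [apply: h | apply/forall_inP => i iB; apply/implyP => _; apply: h].
  by have := h2 i iB; case: eqP => [->|_] /=.
have Dmem t a b : ((t, (a, b)) \in D) = [&& t \in transversal, a \in A j & b \in A j].
  by rewrite in_set.
have sgD w : (sg w \in D) = (w \in D).
  case: w => t [a b]; rewrite /sg !Dmem /= (trans_split t).
  case: (boolP (a \in A j)) => aA; last first.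
    rewrite andbF; apply/negP => /andP[]; rewrite trans_split ffunE eqxx.
    by rewrite (negPf aA).
  by rewrite transE //; do 2 case: (_ \in A j); rewrite ?andbT ?andbF.
have sgI : injective sg.
  move=> [t [a b]] [t' [a' b']] [/ffunP e1 -> e2]; congr (_, (_, _)).
    apply/ffunP => i; have := e1 i; rewrite !ffunE; case: eqP => [->|//] _.
    exact: e2.
  by have := e1 j; rewrite !ffunE eqxx.
have badE : (\sum_(t in transversal)
   #|[set ab in setX (A j) (A j) |
       (0 < pairing (phi ab.1) (G t) * pairing (phi ab.2) (G t))%R]|
   = \sum_(w in D) bad w)%N.
  rewrite big_mkcond /=.
  rewrite [RHS](eq_bigl (fun w => (w.1 \in transversal) && (w.2 \in setX (A j) (A j)))).
    rewrite -[RHS](pair_big_dep (mem transversal) (fun _ ab => ab \in setX (A j) (A j))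
       (fun t ab => (bad (t, ab) : nat))) /= [RHS]big_mkcond /=.
    apply: eq_bigr => t _; case: ifP => // _.
    rewrite -sum1_card -big_mkcondr /=; apply: eq_bigl => ab; by rewrite inE.
  by move=> [t [a b]]; rewrite !inE.
have DE : (\sum_(t in transversal) #|A j| ^ 2 = #|D|)%N.
  rewrite -[in RHS]sum1_card.
  rewrite [RHS](eq_bigl (fun w => (w.1 \in transversal) && (w.2 \in setX (A j) (A j)))).
    rewrite -[RHS](pair_big_dep (mem transversal) (fun _ ab => ab \in setX (A j) (A j))
       (fun t ab => 1%N)) /=.
    by apply: eq_bigr => t _; rewrite sum1_card cardsX -mulnn.
  by move=> [t [a b]]; rewrite !inE.
have shift (F : _ -> nat) : (\sum_(w in D) F (sg w) = \sum_(w in D) F w)%N.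
  by rewrite [RHS](reindex_inj sgI) /=; apply: eq_bigl => w; rewrite sgD.
rewrite badE DE.
have -> : (3 * \sum_(w in D) bad w =
   \sum_(w in D) (bad w + bad (sg w) + bad (sg (sg w))))%N.
  rewrite !big_split /= (shift (fun w => bad (sg w) : nat)) (shift (fun w => bad w : nat)).
  by rewrite !mulSn mul0n addn0 addnA.
rewrite -sum1_card big_distrr /=; apply: leq_sum => -[t [a b]] wD.
pose N g := forall i, i \in B -> i != j -> pairing (phi (t i)) g = 0.
have Nsub : subspace N.
  by move=> x y g h Ng Nh i iB ij; rewrite pairingB Ng // Nh // !mulr0 subrr.
have NE c s : s = upd t j c -> echelon_max (fun g => N g /\ pairing (phi c) g = 0) (G s) (K s).
  move=> sE; have [Ns z nz mx] := GK s; split=> //.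
    split=> [i iB ij|].
      by have := Ns i iB; rewrite sE ffunE (negPf ij).
    by have := Ns j jB; rewrite sE ffunE eqxx.
  move=> h [Nh hc]; apply: mx => i iB; rewrite sE ffunE.
  by case: eqP => [//|/eqP ij]; apply: Nh.
have m1 := NE (t j) t; have m2 := NE a (upd t j a) erefl.
have m3 := NE b (upd (upd t j a) j b).
rewrite /bad /sg /=.
have := not_three_same_signs Nsub (m1 _) m2 (m3 _).
have upd1 : t = upd t j (t j).
  by apply/ffunP => i; rewrite ffunE; case: eqP => [->|].
have upd2 : upd (upd t j a) j b = upd t j b.
  by apply/ffunP => i; rewrite !ffunE; case: eqP.
move=> /(_ upd1 upd2); rewrite (ffunE _ j) eqxx.
do 3 (case: (0 < _)%R => //); by move=> h; case: h.
Qed.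

(* Choose one point in each [A j] at random and a functional vanishing on all of them. Given
   three points of [A j], the functional through at least one of them does not have the
   same sign at the other two, as one sees modulo the points chosen in the other sets; so
   the mean proportion of pairs of [A j] on the same side is at most 2/3. *)
Lemma weak_ham_sandwich : (#|B| < n)%N -> (forall j, j \in B -> A j != set0) ->
  exists2 g, g != 0 &
  (3 * \sum_(j in B) #|[set ab in setX (A j) (A j) |
           (0 < pairing (phi ab.1) g * pairing (phi ab.2) g)%R]|
   <= 2 * \sum_(j in B) #|A j| ^ 2)%N.
Proof.
move=> Bn An.
have [B0|/set0Pn[j0 j0B]] := eqVneq B set0.
  exists (const_mx 1); last by rewrite B0 !big_set0.
  apply/eqP => /matrixP/(_ (Ordinal Bn) ord0); rewrite !mxE; apply/eqP.
  exact: oner_neq0.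
have [x0 _] := set0Pn _ (An j0 j0B).
have [t0 t0T] : exists t, t \in transversal.
  exists [ffun j => odflt x0 [pick x in A j]]; rewrite inE; apply/forall_inP => j jB.
  rewrite ffunE; case: pickP => //= noneA; have [x xA] := set0Pn _ (An j jB).
  by rewrite noneA in xA.
have /boolp.choice [GK GKP] : forall t, exists gk, echelon_max (annihilates t) gk.1 gk.2.
  by move=> t; have [g [k gk]] := echelon_max_exists (annihilator_exists t Bn); exists (g, k).
pose G t := (GK t).1; pose K t := (GK t).2.
pose S g := (3 * \sum_(j in B) #|[set ab in setX (A j) (A j) |
           (0 < pairing (phi ab.1) g * pairing (phi ab.2) g)%R]|)%N.
have tot : (\sum_(t in transversal) S (G t)
            <= \sum_(t in transversal) 2 * \sum_(j in B) #|A j| ^ 2)%N.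
  rewrite -!big_distrr /= exchange_big /= [X in (_ <= 2 * X)%N]exchange_big /=.
  rewrite !big_distrr /=; apply: leq_sum => j jB.
  exact: (average_same_sign (K := K)).
have [t tT tS] : exists2 t, t \in transversal &
    (S (G t) <= 2 * \sum_(j in B) #|A j| ^ 2)%N.
  apply: contrapT => nex; move: tot; apply/negP; rewrite -ltnNge.
  have gtS t : t \in transversal -> (2 * \sum_(j in B) #|A j| ^ 2 < S (G t))%N.
    by move=> tT; rewrite ltnNge; apply/negP => h; apply: nex; exists t.
  rewrite (bigD1 t0) //= [X in (_ < X)%N](bigD1 t0) //= -addSn.
  apply: leq_add; first exact: gtS.
  by apply: leq_sum => t /andP[tT _]; apply/ltnW/gtS.
exists (G t) => //.
have [_ _ + _] := GKP t; apply: contraNneq => g0.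
by rewrite /= -/(G t) g0 mxE.
Qed.

End Averaging.
End WeakHamSandwich.

(** * Polynomial partitioning *)

Section TrivariateEvaluation.
Variable R : realFieldType.
Local Notation A := {poly R}.
Local Notation S := {poly {poly {poly R}}}.

Definition evp (g : S) (x y t : R) : R := g.[y%:P%:P].[x%:P].[t].

Lemma horner_on_curve (g : S) (X Y : A) t :
  (g.[Y%:P].[X]).[t] = evp g X.[t] Y.[t] t.
Proof.
suff E (X' Y' : A) : (g.[Y'%:P].[X']).[t] =
    (map_poly (map_poly (horner_eval t)) g).[(Y'.[t])%:P].[X'.[t]].
  by rewrite E /evp E !hornerC.
rewrite !horner2_map -[LHS]/(horner_eval t _) -horner_map /=; congr (_.[_]).
apply/polyP => i; rewrite !coef_map /=.
by rewrite -[LHS]/(horner_eval t _) -horner_map /=.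
Qed.

Definition poly3 d (c : 'I_d.+1 * 'I_d.+1 * 'I_d.+1 -> R) : S :=
  \poly_(j < d.+1) \poly_(i < d.+1) \poly_(k < d.+1) c (inord j, inord i, inord k).

Lemma coef_poly3 d c (j i k : 'I_d.+1) : ((((poly3 c)`_j)`_i)`_k) = c (j, i, k).
Proof. by rewrite !coef_poly !ltn_ord !coef_poly !ltn_ord coef_poly ltn_ord !inord_val. Qed.

Lemma poly3_tribounded d (c : 'I_d.+1 * 'I_d.+1 * 'I_d.+1 -> R) :
  tribounded d (poly3 c).
Proof.
apply/and3P; split; first exact: size_poly.
  apply/sizeY_leP => j; rewrite coef_poly; case: ifP => _; rewrite ?size_poly0 ?size_poly //.
apply/degT_leP => i j; rewrite coef_poly; case: ifP => _; rewrite ?coef0 ?size_poly0 //.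
by rewrite coef_poly; case: ifP => _; rewrite ?size_poly0 ?size_poly.
Qed.

Lemma evp_poly3 d (c : 'I_d.+1 * 'I_d.+1 * 'I_d.+1 -> R) x y t :
  evp (poly3 c) x y t = \sum_w c w * (y ^+ w.1.1 * x ^+ w.1.2 * t ^+ w.2).
Proof.
rewrite /evp /poly3 horner_poly.
rewrite (big_morph (fun p : {poly {poly R}} => p.[x%:P].[t]) (id1 := 0) (op1 := +%R));
  first last.
- by rewrite !horner0.
- by move=> p q; rewrite !hornerD.
rewrite [RHS](eq_bigr (fun w => c (w.1, w.2) * (y ^+ w.1.1 * x ^+ w.1.2 * t ^+ w.2)));
  last by case.
rewrite -(pair_bigA _ (fun u k => c (u, k) * (y ^+ u.1 * x ^+ u.2 * t ^+ k))) /=.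
rewrite [RHS](eq_bigr (fun u => \sum_k c (u.1, u.2, k) * (y ^+ u.1 * x ^+ u.2 * t ^+ k)));
  last by case.
rewrite -(pair_bigA _ (fun j i => \sum_k c (j, i, k) * (y ^+ j * x ^+ i * t ^+ k))) /=.
apply: eq_bigr => j _; rewrite !hornerM -!rmorphXn /= !hornerC horner_poly horner_sum.
rewrite mulr_suml; apply: eq_bigr => i _.
rewrite hornerM -rmorphXn /= hornerC horner_poly !mulr_suml; apply: eq_bigr => k _.
rewrite !inord_val; ring.
Qed.

End TrivariateEvaluation.

(** * Signs of polynomials along a line *)

Section SignPatterns.
Variable R : rcfType.

(** Between consecutive times with different signs some polynomial has a root, by the intermediate
    value theorem. The bound [all (> t) rs] keeps the roots of the induction beyond [s], so the new
    one is different. *)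
Lemma sorted_sign_changes (hs : seq {poly R}) (t : R) (ts : seq R) :
  (forall h, h \in hs -> forall s, s \in t :: ts -> h.[s] != 0) ->
  uniq [seq [seq 0 < h.[s] | h <- hs] | s <- t :: ts] ->
  path <%R t ts ->
  exists rs : seq R, [/\ size rs = size ts, uniq rs,
     all (root (\prod_(h <- hs) h)) rs & all (> t) rs].
Proof.
elim: ts t => [|s ts IHts] t nz; first by exists [::].
rewrite [in X in X -> _]/= => /andP[tn un] /= /andP[ts_lt pth].
have [|rs [srs urs rrs ars]] := IHts s _ un pth.
  by move=> h hh s' s's; apply: nz => //; rewrite inE s's orbT.
have [h hh hdif] : exists2 h, h \in hs & (0 < h.[t]) != (0 < h.[s]).
  apply: contrapT => nex; move: tn; rewrite inE => /norP[/eqP tn _]; apply: tn.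
  apply/eq_in_map => h hh; apply/eqP/negPn/negP => hd; apply: nex; by exists h.
have ht := nz h hh t (mem_head _ _).
have hs' : h.[s] != 0 by apply: nz => //; rewrite inE mem_head orbT.
have [r /andP[tr rs'] hr] : exists2 r, t <= r <= s & root h r.
  have le_ts := ltW ts_lt.
  move: hdif; case: (ltgtP 0 h.[t]) ht => // h1 _; case: (ltgtP 0 h.[s]) hs' => // h2 _ _.
    have [|r ir hr] := @poly_ivt _ (- h) t s le_ts.
    - by rewrite !hornerN oppr_le0 oppr_ge0 !ltW.
    - by exists r => //; rewrite rootE hornerN oppr_eq0 in hr.
  have [|r ir hr] := @poly_ivt _ h t s le_ts; first by rewrite !ltW.
  by exists r.
have rt : t < r.
  rewrite lt_neqAle tr andbT; apply: contraNneq ht => ->; exact: hr.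
have rs'' : r < s.
  by rewrite lt_neqAle rs' andbT; apply: contraNneq hs' => <-; exact: hr.
exists (r :: rs); split=> /=.
- by rewrite srs.
- rewrite urs andbT; apply/negP => /(allP ars) /=.
  by rewrite ltNge ltW.
- rewrite rrs andbT; case/splitPr: hh => l1 l2.
  by rewrite rootE big_cat big_cons /= !hornerM (eqP hr) mul0r mulr0.
- by rewrite rt /=; apply/allP => q /(allP ars) /=; apply: lt_trans.
Qed.

Lemma sign_patterns_le (hs : seq {poly R}) (ts : seq R) :
  (forall h, h \in hs -> h != 0) ->
  (forall h, h \in hs -> forall s, s \in ts -> h.[s] != 0) ->
  uniq [seq [seq 0 < h.[s] | h <- hs] | s <- ts] ->
  (size ts <= size (\prod_(h <- hs) h)%R)%N.
Proof.
move=> hs0 nz un; pose us := sort <=%R ts.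
have pus : perm_eq us ts by rewrite perm_sort.
have memE : us =i ts by apply: perm_mem.
rewrite -(perm_size pus).
have uu : uniq [seq [seq 0 < h.[s] | h <- hs] | s <- us].
  by rewrite (perm_uniq (perm_map _ pus)).
have srt : sorted <%R us.
  by rewrite lt_sorted_uniq_le (map_uniq uu) sort_le_sorted.
have P0 : \prod_(h <- hs) h != 0.
  by rewrite prodf_seq_neq0; apply/allP => h hh; rewrite hs0.
case E : us srt => [|t us'] //= pth.
have [||rs [srs urs rrs _]] := sorted_sign_changes (hs := hs) _ _ pth.
- by move=> h hh s ss; apply: nz => //; rewrite -memE E.
- by rewrite -E.
by rewrite -srs; apply: max_poly_roots.
Qed.

End SignPatterns.

Section PolynomialPartition.
Variables (R : rcfType) (Pt : finType) (px py pt : Pt -> R).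
Local Notation A := {poly R}.
Local Notation S := {poly {poly {poly R}}}.
Implicit Types (gs : seq S) (g : S) (X : {set Pt}).

Definition ev g (a : Pt) := evp g (px a) (py a) (pt a).

Definition off_zeros gs a := all (fun g => ev g a != 0) gs.

Definition signs gs a := [seq 0 < ev g a | g <- gs].

(** Cells are classes of points with equal signs, instead of connected components of the
    complement. *)
Definition cell X gs a := [set b in X | off_zeros gs b && (signs gs b == signs gs a)].

Definition big_cell (M : nat) X (C : {set Pt}) := (#|X| < #|C| * M)%N.

(** The number of these pairs is the potential of the iteration: a well chosen polynomial multiplies
    it by at most 2/3, while a single big cell contributes the square of its size. *)
Definition same_big_cell M X gs := [set ab : Pt * Pt |
  [&& ab.1 \in X, off_zeros gs ab.1, ab.2 \in cell X gs ab.1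
    & big_cell M X (cell X gs ab.1)]].

Let big_cells M X gs := [set C in [set cell X gs a | a in X] | big_cell M X C].

Lemma cell_eq X gs a b : b \in cell X gs a -> cell X gs b = cell X gs a.
Proof.
by rewrite inE => /and3P[_ _ /eqP e]; apply/setP => c; rewrite !inE e.
Qed.

Lemma big_cellsP M X gs C a : C \in big_cells M X gs -> a \in C -> C = cell X gs a.
Proof. by rewrite inE => /andP[/imsetP[b _ ->] _] /cell_eq. Qed.

Lemma big_cells_trivIset M X gs : trivIset (big_cells M X gs).
Proof.
apply/trivIsetP => C D CB DB CD; rewrite -setI_eq0; apply/eqP/setP => a.
rewrite !inE; apply/negP => /andP[aC aD].
by move: CD; rewrite (big_cellsP CB aC) (big_cellsP DB aD) eqxx.
Qed.

Lemma card_big_cells_lt M X gs : (0 < M)%N -> (#|big_cells M X gs| < M)%N.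
Proof.
move=> M0; set B := big_cells M X gs.
have [->|[C CB]] := set_0Vmem B; first by rewrite cards0.
have sum_le : (\sum_(C in B) #|C| <= #|X|)%N.
  rewrite (eqP (big_cells_trivIset M X gs)); apply/subset_leq_card/bigcupsP => D.
  by rewrite inE => /andP[/imsetP[b _ ->] _]; apply/subsetP => a; rewrite inE => /andP[].
have : (#|B| * #|X| < #|X| * M)%N.
  apply: leq_trans (_ : \sum_(C in B) #|C| * M <= _)%N; last first.
    by rewrite -big_distrl /= leq_mul2r sum_le orbT.
  rewrite -sum_nat_const (bigD1 C) //= [X in (_ < X)%N](bigD1 C) //= -addSn.
  apply: leq_add; first by move: CB; rewrite inE => /andP[].
  by apply: leq_sum => D /andP[]; rewrite inE => /andP[_ /ltnW].
by rewrite mulnC ltn_mul2l => /andP[].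
Qed.

Lemma sum_big_cells_le M X gs :
  (\sum_(C in big_cells M X gs) #|C| ^ 2 <= #|same_big_cell M X gs|)%N.
Proof.
rewrite (eq_bigr (fun C => \sum_(ab : Pt * Pt) (ab \in setX C C : nat))%N); last first.
  by move=> C _; rewrite -mulnn -cardsX -sum1_card big_mkcond.
rewrite exchange_big /= -sum1_card [X in (_ <= X)%N]big_mkcond /=.
apply: leq_sum => -[a b] _; case: ifP => [_|nab].
  have [[C CB abC]|none] := pselect (exists2 C, C \in big_cells M X gs & (a, b) \in setX C C).
    rewrite (bigD1 C) //= abC big1 ?addn0 // => D /andP[DB DC].
    apply/eqP; rewrite eqb0; apply: contra DC; rewrite !inE /= => /andP[aD _].
    move: abC; rewrite !inE /= => /andP[aC _].
    by rewrite (big_cellsP CB aC) (big_cellsP DB aD).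
  rewrite big1 // => C CB; apply/eqP; rewrite eqb0; apply/negP => h.
  by apply: none; exists C.
rewrite leqn0; apply/eqP/big1 => C CB; apply/eqP; rewrite eqb0; apply/negP.
rewrite !inE /= => /andP[aC bC]; move/negP: nab; apply.
have CE := big_cellsP CB aC; move: (aC) bC; rewrite CE !inE /=.
move=> /and3P[-> -> _] /and3P[-> -> ->] /=.
by move: CB; rewrite inE CE => /andP[].
Qed.

Lemma same_big_cell_cons M X gs g a b : (a, b) \in same_big_cell M X (g :: gs) ->
  cell X gs a \in big_cells M X gs /\
  [&& a \in cell X gs a, b \in cell X gs a & 0 < ev g a * ev g b].
Proof.
rewrite !inE /= => /and4P[aX /andP[ga oa] /and3P[bX /andP[gb ob]]].
rewrite eqseq_cons => /andP[sg /eqP sgs] big; split.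
  apply/andP; split; first by apply/imsetP; exists a.
  apply: leq_trans big _; rewrite leq_mul2r; apply/orP; right; apply: subset_leq_card.
  apply/subsetP => c; rewrite !inE /= eqseq_cons.
  by move=> /and3P[-> /andP[_ ->] /andP[_ ->]].
rewrite aX oa bX ob sgs !eqxx /=; move: sg ga gb.
by case: (ltgtP 0 (ev g a)) => // h1; case: (ltgtP 0 (ev g b)) => // h2 _ _ _;
  [rewrite mulr_gt0 | rewrite nmulr_rgt0].
Qed.

(** The weak ham sandwich theorem applied to the monomial embedding [phi]. Fewer than [M] big cells
    are to be split, and there are [d.+1 ^ 3] coefficients to do it. *)
Lemma refine_partition d M X gs : (0 < M <= d.+1 ^ 3)%N ->
  exists g, [/\ g != 0, tribounded d g &
    (3 * #|same_big_cell M X (g :: gs)| <= 2 * #|same_big_cell M X gs|)%N].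
Proof.
move=> /andP[M0 Md].
pose I := ('I_d.+1 * 'I_d.+1 * 'I_d.+1)%type.
pose mono (a : Pt) (w : I) := py a ^+ w.1.1 * px a ^+ w.1.2 * pt a ^+ w.2.
pose phi (a : Pt) : 'rV[R]_#|{: I}| := \row_m mono a (enum_val m).
pose pol (c : 'cV[R]_#|{: I}|) : S := poly3 (fun w : I => c (enum_rank w) ord0).
have pairE a c : pairing (phi a) c = ev (pol c) a.
  rewrite /pairing mxE /ev evp_poly3 (reindex (@enum_rank I)) /=; last first.
    by exists enum_val => w _; rewrite ?enum_rankK ?enum_valK.
  by apply: eq_bigr => w _; rewrite mxE enum_rankK mulrC.
pose B := big_cells M X gs.
have Bn : (#|B| < #|{: I}|)%N.
  rewrite !card_prod card_ord; apply: leq_trans (card_big_cells_lt X gs M0) _.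
  by apply: leq_trans Md _; rewrite !expnS expn0 muln1 mulnA.
have B0 C : C \in B -> C != set0.
  rewrite inE => /andP[_ big]; apply: contraTneq big => ->.
  by rewrite /big_cell cards0.
have [c c0 hc] := weak_ham_sandwich phi (A := id) Bn B0.
exists (pol c); split.
- have /matrix0Pn [i [j cij]] := c0; rewrite (ord1 j) in cij.
  case E : (enum_val i) => [[w1 w2] w3].
  apply: contraNneq cij => p0; have := coef_poly3 (fun w : I => c (enum_rank w) ord0) w1 w2 w3.
  by rewrite -E enum_valK -/(pol c) p0 !coef0 => <-.
- exact: poly3_tribounded.
apply: leq_trans (leq_trans hc _); last by rewrite leq_mul2l sum_big_cells_le orbT.
rewrite leq_mul2l /=.
apply: leq_trans (_ : #|\bigcup_(C in B) [set ab in setX C C |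
   (0 < pairing (phi ab.1) c * pairing (phi ab.2) c)%R]| <= _)%N.
  apply/subset_leq_card/subsetP => -[a b] /same_big_cell_cons [CB /and3P[aC bC pos]].
  by apply/bigcupP; exists (cell X gs a) => //; rewrite in_set in_setX /= aC bC !pairE.
elim/big_rec2: _ => [|C m E CB]; first by rewrite cards0.
by move=> h; apply: leq_trans (leq_card_setU _ _) _; rewrite leq_add2l.
Qed.

Lemma iterated_partition d M X k : (0 < M <= d.+1 ^ 3)%N ->
  exists gs, [/\ size gs = k, forall g, g \in gs -> g != 0 /\ tribounded d g &
    (3 ^ k * #|same_big_cell M X gs| <= 2 ^ k * #|X| ^ 2)%N].
Proof.
move=> Md; elim: k => [|k [gs [sgs gP le_gs]]].
  exists [::]; split=> //; rewrite !mul1n -mulnn -cardsX; apply: subset_leq_card.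
  by apply/subsetP => -[a b]; rewrite !inE /= => /and3P[-> /andP[->]].
have [g [g0 gd le_g]] := refine_partition X gs Md.
exists (g :: gs); split=> /=; first by rewrite sgs.
  by move=> h; rewrite inE => /orP[/eqP->|/gP].
rewrite (expnS 3) (expnS 2 k); apply: leq_trans (_ : 3 ^ k * (2 * #|same_big_cell M X gs|) <= _)%N.
  by rewrite -mulnA mulnCA leq_mul2l le_g orbT.
by rewrite mulnCA -mulnA leq_mul2l le_gs orbT.
Qed.

(** After [k] steps at most [(2/3)^k #|X|^2 <= (#|X| / M)^2] pairs remain in big cells, fewer than
    one big cell would provide. *)
Theorem polynomial_partition d M X k : (0 < M <= d.+1 ^ 3)%N ->
  (M ^ 2 * 2 ^ k <= 3 ^ k)%N ->
  exists gs, [/\ size gs = k, forall g, g \in gs -> g != 0 /\ tribounded d g &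
    forall a, a \in X -> off_zeros gs a -> (#|cell X gs a| * M <= #|X|)%N].
Proof.
move=> Md Mk; have [gs [sgs gP le_gs]] := iterated_partition X k Md.
exists gs; split=> // a aX oa; rewrite leqNgt; apply/negP => big.
have sub : (#|cell X gs a| ^ 2 <= #|same_big_cell M X gs|)%N.
  rewrite -mulnn -cardsX; apply/subset_leq_card/subsetP => -[b c].
  rewrite in_setX => /andP[/= ba ca]; rewrite inE /= (cell_eq ba).
  by rewrite ca /big_cell big andbT; move: ba; rewrite inE => /and3P[-> -> _].
have X0 : (0 < #|X|)%N by apply/card_gt0P; exists a.
have : (M ^ 2 * (3 ^ k * #|cell X gs a| ^ 2) <= 3 ^ k * #|X| ^ 2)%N.
  apply: leq_trans (_ : M ^ 2 * (2 ^ k * #|X| ^ 2) <= _)%N.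
    by rewrite leq_mul2l (leq_trans _ le_gs) ?orbT // leq_mul2l sub orbT.
  by rewrite mulnA leq_mul2r Mk orbT.
rewrite mulnCA leq_pmul2l ?expn_gt0 // -expnMn leqNgt => /negP; apply.
by rewrite ltn_exp2r // mulnC.
Qed.

End PolynomialPartition.

(** * Lines crossing a polynomial partition *)

Section LinesAndPartitions.
Variables (R : rcfType) (T Pt : finType).
Variables (px py pt : Pt -> R) (lX lY : T -> {poly R}).
Local Notation A := {poly R}.
Local Notation S := {poly {poly {poly R}}}.
Implicit Types (gs : seq S) (f g : S) (X : {set Pt}).
Hypothesis loc_inj : injective (fun a => (px a, py a, pt a)).
Hypothesis line_injective : injective (fun l => (lX l, lY l)).
Hypothesis size_lX : forall l, (size (lX l) <= 2)%N.
Hypothesis size_lY : forall l, (size (lY l) <= 2)%N.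

Local Notation ev := (ev px py pt).
Local Notation off_zeros := (off_zeros px py pt).
Local Notation cell := (cell px py pt).

Definition incident l a := ((lX l).[pt a] == px a) && ((lY l).[pt a] == py a).

Definition restriction f l : A := f.[(lY l)%:P].[lX l].

Definition surface_lines f : {set T} := [set l | restriction f l == 0].

(** A surface is represented by the set of lines it contains: the family is finite, and associated
    polynomials give the same member. *)
Definition surfaces D : {set {set T}} :=
  [set Z | `[< exists f, [/\ irred f, tribounded D f & Z = surface_lines f] >]].

Lemma surfacesP D Z : reflect
  (exists f, [/\ irred f, tribounded D f & Z = surface_lines f]) (Z \in surfaces D).
Proof. by rewrite inE; apply: asboolP. Qed.

Lemma incident_ev f l a : incident l a -> (restriction f l).[pt a] = ev f a.
Proof. by move=> /andP[/eqP ex /eqP ey]; rewrite horner_on_curve ex ey. Qed.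

Lemma incident_pt_inj l a b : incident l a -> incident l b -> pt a = pt b -> a = b.
Proof.
move=> /andP[/eqP ax /eqP ay] /andP[/eqP bx /eqP by_] e; apply: loc_inj.
by rewrite -ax -ay -bx -by_ e.
Qed.

Lemma surfaces_meet D Z1 Z2 : Z1 \in surfaces D -> Z2 \in surfaces D -> Z1 != Z2 ->
  (#|Z1 :&: Z2| <= 2 * D * D * D)%N.
Proof.
move=> /surfacesP [f [firr fD ->]] /surfacesP [g [girr gD ->]] ne.
have uA : ufd A by exact/ufd_poly/ufd_field.
have /and3P[f1 f2 _] := fD; have /and3P[g1 g2 _] := gD.
have dvd_sub (h1 h2 : S) : divides h1 h2 -> surface_lines h1 \subset surface_lines h2.
  move=> [q ->]; apply/subsetP => l; rewrite !inE /restriction !hornerM => /eqP->.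
  by rewrite mulr0.
apply: (irred_common_zeros (zX := lX) (zY := lY) uA firr _ f1 g1 f2 g2 line_injective).
- move=> fg; move/eqP: ne; apply; apply/eqP; rewrite eqEsubset.
  by rewrite !dvd_sub //; apply: irred_divides_irred.
- by move=> l; rewrite !inE => /andP[/eqP].
- by move=> l; rewrite !inE => /andP[_ /eqP].
Qed.

Lemma incident_surface_le D f l : tribounded D f -> l \notin surface_lines f ->
  (#|[set a in [set a | ev f a == 0%R] | incident l a]| <= 3 * D)%N.
Proof.
move=> fD; rewrite inE => nz; rewrite -ltnS.
apply: leq_trans (size_horner2_le fD (size_lX l) (size_lY l)).
apply: (card_roots_lt (y := pt)) => // [a b|a]; rewrite !inE.
  by move=> /andP[_ ia] /andP[_ ib]; apply: incident_pt_inj ia ib.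
by move=> /andP[/eqP fa ia]; rewrite rootE (incident_ev _ ia) fa.
Qed.

Lemma size_prod_restrictions D gs l : (forall g, g \in gs -> tribounded D g) ->
  (size (\prod_(g <- gs) restriction g l)%R <= (3 * D * size gs).+1)%N.
Proof.
elim: gs => [|g gs IHgs] gD; first by rewrite big_nil size_poly1.
rewrite big_cons; apply: leq_trans (size_polyMleq _ _) _.
have h1 := size_horner2_le (gD g (mem_head _ _)) (size_lX l) (size_lY l).
have h2 := IHgs (fun h hh => gD h (mem_behead (s := g :: gs) hh)).
rewrite /= mulnS -subn1 leq_subLR; apply: leq_trans (leq_add h1 h2) _.
by rewrite addSn addnS add1n.
Qed.

(** The cells met by a line are sign patterns along it, at most one more than the degree of the
    product. If some polynomial vanishes on the whole line, none of its points lies in a cell. *)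
Lemma cells_on_line_le D X gs l : (forall g, g \in gs -> tribounded D g) ->
  (#|[set cell X gs a | a in [set a in X | off_zeros gs a && incident l a]]|
     <= (3 * D * size gs).+1)%N.
Proof.
move=> gD; set P := [set a in X | _]; set img := [set _ | _ in _].
have [z|nz] := pselect (exists2 g, g \in gs & restriction g l = 0).
  rewrite (_ : img = set0) ?cards0 //; apply/setP => C; rewrite inE.
  apply/negP => /imsetP [a]; rewrite inE => /and3P[_ oa ia] _.
  have [g ggs g0] := z; move/allP/(_ g ggs): oa.
  by rewrite -(incident_ev g ia) g0 horner0 eqxx.
apply: leq_trans (size_prod_restrictions l gD).
have [->|[C0 /imsetP[a0 _ _]]] := set_0Vmem img; first by rewrite cards0.
have /boolp.choice [rep repP] : forall C, exists a, C \in img -> a \in P /\ C = cell X gs a.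
  move=> C.
  by have [/imsetP[a aP CE]|nC] := boolP (C \in img); [exists a | exists a0].
rewrite cardE -(size_map (fun C => pt (rep C))).
have -> : \prod_(g <- gs) restriction g l = \prod_(h <- [seq restriction g l | g <- gs]) h.
  by rewrite big_map.
apply: sign_patterns_le.
- by move=> _ /mapP[g ggs ->]; apply/eqP => g0; apply: nz; exists g.
- move=> _ /mapP[g ggs ->] _ /mapP[C + ->]; rewrite mem_enum => /repP [].
  rewrite inE => /and3P[_ oa ia] _; rewrite (incident_ev _ ia).
  exact: (allP oa).
- rewrite -map_comp map_inj_in_uniq ?enum_uniq // => C C'; rewrite !mem_enum.
  move=> /repP [] + CE /repP [] + CE'; rewrite !inE => /and3P[_ oa ia] /and3P[_ ob ib].
  rewrite /= -!map_comp => e; rewrite CE CE'.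
  have -> // : cell X gs (rep C) = cell X gs (rep C').
  apply/setP => c; rewrite !inE; congr (_ && (_ && (_ == _))).
  rewrite /signs; under eq_map => g do rewrite -(incident_ev g ia).
  by under [RHS]eq_map => g do rewrite -(incident_ev g ib).
Qed.

Lemma factor_list D gs : (forall g, g \in gs -> g != 0 /\ tribounded D g) ->
  exists L : seq S, [/\ (size L <= 3 * D * size gs)%N,
    forall f, f \in L -> irred f /\ tribounded D f &
    forall a, ~~ off_zeros gs a -> exists2 f, f \in L & ev f a = 0].
Proof.
elim: gs => [|g gs IHgs] gP; first by exists [::].
have [L [sL LP Lz]] := IHgs (fun h hh => gP h (mem_behead (s := g :: gs) hh)).
have [g0 gD] := gP g (mem_head _ _).
have [u [fs [uu gE firr sfs]]] := factorization g0.
exists (fs ++ L); split.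
- rewrite size_cat /= mulnS leq_add //; apply: leq_trans sfs _.
  have /and3P[h1 h2 h3] := gD; rewrite /tridegree.
  have -> : (3 * D = D + D + D)%N by lia.
  have pl n : (n <= D.+1)%N -> (n.-1 <= D)%N by case: n.
  by rewrite !leq_add // pl.
- move=> f; rewrite mem_cat => /orP[ffs|/LP//]; split; first exact: firr.
  apply: tribounded_divisor gD => //.
  rewrite gE; apply: dividesMl; case/splitPr: ffs => l1 l2.
  by rewrite big_cat big_cons /=; apply/dividesMl/dividesMr; exists 1; rewrite mul1r.
move=> a /=; rewrite negb_and => /orP[|/Lz [f fL fa]]; last first.
  by exists f; rewrite // mem_cat fL orbT.
rewrite negbK => /eqP ga.
have evM (h1 h2 : S) : ev (h1 * h2) a = ev h1 a * ev h2 a.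
  by rewrite /ev /evp !hornerM.
have ev1 : ev 1 a = 1 by rewrite /ev /evp !hornerC.
have /eqP : ev u a * \prod_(f <- fs) ev f a = 0.
  by rewrite -ga {1}gE evM; congr (_ * _); rewrite (big_morph (fun f => ev f a) evM ev1).
have : ev u a != 0.
  by apply/eqP => u0; have /eqP := evM u^-1 u; rewrite mulVr // ev1 u0 mulr0 oner_eq0.
rewrite mulf_eq0 => /negPf -> /=; rewrite prodf_seq_eq0 => /hasP [f ffs /= /eqP fa].
by exists f; rewrite // mem_cat ffs.
Qed.

(** All that the induction uses, with no polynomial left: the color is the cell, and each [w] in
    [Zs] pairs the points and the lines of an irreducible factor. Writing [k.+1] for [k] lets one
    constant bound both the cells met by a line and its points on a surface. *)
Theorem lines_partition d M k X : (0 < M <= d.+1 ^ 3)%N -> (M ^ 2 * 2 ^ k <= 3 ^ k)%N ->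
  exists (Y : {set Pt}) (color : Pt -> {set Pt}) (Zs : seq ({set Pt} * {set T})),
  [/\ Y \subset X,
      forall a, a \in Y -> (#|[set b in Y | color b == color a]| * M <= #|X|)%N,
      forall l, (#|[set color a | a in [set a in Y | incident l a]]| <= (3 * d * k.+1).+1)%N,
      (size Zs <= 3 * d * k)%N /\
      (forall a, a \in X -> a \notin Y -> exists2 w, w \in Zs & a \in w.1) &
      forall w, w \in Zs -> w.2 \in surfaces d /\ forall l, l \notin w.2 ->
        (#|[set a in w.1 | incident l a]| <= (3 * d * k.+1).+1)%N].
Proof.
move=> Md Mk; have [gs [sgs gP gcell]] := polynomial_partition px py pt X Md Mk.
have [L [sL LP Lz]] := factor_list gP.
exists [set a in X | off_zeros gs a], (cell X gs),
  [seq ([set a | ev f a == 0], surface_lines f) | f <- L]; split.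
- by apply/subsetP => a; rewrite inE => /andP[].
- move=> a; rewrite inE => /andP[aX oa]; apply: leq_trans (gcell a aX oa).
  rewrite leq_mul2r; apply/orP; right; apply/subset_leq_card/subsetP => b.
  rewrite inE => /andP[+ /eqP <-]; rewrite !inE => /andP[-> ->].
  by rewrite eqxx.
- move=> l; have gD g : g \in gs -> tribounded d g by case/gP.
  apply: leq_trans (_ : (3 * d * size gs).+1 <= _)%N; last first.
    by rewrite sgs ltnS leq_mul2l leqnSn orbT.
  apply: leq_trans (cells_on_line_le X l gD).
  apply: subset_leq_card; apply: imsetS; apply/subsetP => a.
  by rewrite !inE andbA.
- rewrite size_map -sgs; split=> // a aX; rewrite inE aX /= => /Lz [f fL fa].
  by exists ([set a | ev f a == 0], surface_lines f); [apply: map_f | rewrite inE fa].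
move=> _ /mapP[f fL ->] /=; have [firr fD] := LP f fL; split.
  by apply/surfacesP; exists f.
move=> l /(incident_surface_le fD) h; apply: leq_trans h _.
by rewrite mulnS; apply: leqW; apply: leq_addr.
Qed.

End LinesAndPartitions.

(** * Rich points of lines *)

Section DoubleCounting.

Lemma sum_sqr_le (I : finType) (P : {set I}) (a : I -> nat) :
  ((\sum_(i in P) a i) ^ 2 <= #|P| * \sum_(i in P) a i ^ 2)%N.
Proof.
rewrite -(leq_pmul2l (isT : 0 < 2)%N).
have -> : (2 * (\sum_(i in P) a i) ^ 2 = \sum_(i in P) \sum_(j in P) 2 * (a i * a j))%N.
  rewrite -mulnn big_distrlr /= big_distrr /=; apply: eq_bigr => i _.
  by rewrite big_distrr.
apply: leq_trans (_ : \sum_(i in P) \sum_(j in P) (a i ^ 2 + a j ^ 2) <= _)%N.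
  by apply: leq_sum => i _; apply: leq_sum => j _; apply: nat_Cauchy.
rewrite (eq_bigr (fun i => #|P| * a i ^ 2 + \sum_(j in P) a j ^ 2)%N); last first.
  by move=> i _; rewrite big_split /= sum_nat_const.
by rewrite big_split /= -big_distrr /= sum_nat_const mul2n -addnn.
Qed.

Variables (U T : finType) (e : U -> T -> bool) (L : {set T}).

Lemma sum_degrees (A : {set U}) :
  (\sum_(x in A) #|[set l in L | e x l]| = \sum_(l in L) #|[set x in A | e x l]|)%N.
Proof.
rewrite (eq_bigr (fun x => \sum_(l in L) (e x l : nat))%N); last first.
  move=> x _; rewrite -sum1_card [RHS]big_mkcond [LHS]big_mkcond /=.
  by apply: eq_bigr => l _; rewrite inE; case: (l \in L); case: (e x l).
rewrite exchange_big /=; apply: eq_bigr => l _.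
rewrite -sum1_card [RHS]big_mkcond [LHS]big_mkcond /=.
by apply: eq_bigr => x _; rewrite inE; case: (x \in A); case: (e x l).
Qed.

(** Cauchy-Schwarz over [L]; the sum of the squared degrees counts common neighbours of pairs, the
    diagonal giving [s]. *)
Lemma incidences_sqr_le (A : {set U}) (B s : nat) :
  (forall x y, x \in A -> y \in A -> x != y -> (#|[set l in L | e x l && e y l]| <= B)%N) ->
  s = (\sum_(x in A) #|[set l in L | e x l]|)%N ->
  (s ^ 2 <= #|L| * (s + B * #|A| ^ 2))%N.
Proof.
move=> common sE; rewrite [X in (X ^ 2 <= _)%N]sE sum_degrees.
apply: leq_trans (sum_sqr_le _ _) _; rewrite leq_mul2l; apply/orP; right.
rewrite (eq_bigr (fun l => \sum_(x in A) \sum_(y in A) (e x l && e y l : nat))%N); last first.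
  move=> l _; rewrite -mulnn -sum1_card [X in (X * X)%N]big_mkcond.
  rewrite [X in (X * X)%N](_ : _ = \sum_(x in A) (e x l : nat))%N.
    rewrite big_distrlr /=; apply: eq_bigr => x _; apply: eq_bigr => y _.
    by rewrite mulnb.
  rewrite [RHS]big_mkcond /=; apply: eq_bigr => x _.
  by rewrite inE; case: (x \in A); case: (e x l).
rewrite exchange_big /=.
rewrite (eq_bigr (fun x => \sum_(y in A) #|[set l in L | e x l && e y l]|)%N); last first.
  move=> x _; rewrite exchange_big /=; apply: eq_bigr => y _.
  rewrite -sum1_card [RHS]big_mkcond [LHS]big_mkcond /=.
  by apply: eq_bigr => l _; rewrite inE; case: (l \in L); case: (e x l); case: (e y l).
apply: leq_trans (_ : \sum_(x in A) (#|[set l in L | e x l]| + \sum_(y in A) B) <= _)%N.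
  apply: leq_sum => x xA; rewrite (bigD1 x) //= leq_add //.
    by apply/subset_leq_card/subsetP => l; rewrite !inE andbb.
  rewrite [X in (_ <= X)%N](bigD1 x) //=; apply: leq_trans (leq_addl _ _).
  by apply: leq_sum => y /andP[yA yx]; apply: common; rewrite // eq_sym.
rewrite big_split /= -sE leq_add2l !sum_nat_const mulnA mulnC leq_mul2l.
by rewrite -mulnn leqnn orbT.
Qed.

End DoubleCounting.

Section RichPoints.
Variables (T Pt : finType) (inc : T -> Pt -> bool).
Hypothesis inc_unique : forall l l' x y, l != l' ->
  inc l x -> inc l' x -> inc l y -> inc l' y -> x = y.
Implicit Types (L : {set T}) (r : nat).

Definition lines_through L x := [set l in L | inc l x].

Definition rich L r : {set Pt} := [set x | (r <= #|lines_through L x|)%N].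

(** Each such point lies on [h.+1 * h] ordered pairs of distinct lines, and two lines meet at most
    once. *)
Lemma rich_pairs L h : (#|rich L h.+1| * (h.+1 * h) <= #|L| ^ 2)%N.
Proof.
pose D := [set ll : T * T | ll \in setX L L & ll.1 != ll.2].
apply: leq_trans (_ : \sum_(x in rich L h.+1) #|[set ll in D | inc ll.1 x && inc ll.2 x]| <= _)%N.
  rewrite -sum_nat_const; apply: leq_sum => x; rewrite inE => rx.
  pose A := lines_through L x.
  apply: leq_trans (_ : \sum_(l in A) #|A :\ l| <= _)%N.
    rewrite (eq_bigr (fun _ => #|A|.-1)) => [|l lA].
      by rewrite sum_nat_const leq_mul //; move: rx; rewrite -/A; case: #|A|.
    by rewrite (cardsD1 l A) lA.
  rewrite (eq_bigr (fun l => \sum_(l' in A :\ l) 1)%N); last by move=> l _; rewrite sum1_card.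
  rewrite pair_big_dep sum1_card; apply/subset_leq_card/subsetP => -[l l'].
  rewrite unfold_in /= !inE /= => /andP[/andP[lL lx] /and3P[ne l'L l'x]].
  by rewrite lL l'L lx l'x eq_sym ne.
rewrite (sum_degrees (fun x (ll : T * T) => inc ll.1 x && inc ll.2 x) D).
apply: leq_trans (_ : \sum_(ll in D) 1 <= _)%N.
  apply: leq_sum => -[l l']; rewrite !inE /= => /andP[_ ne].
  apply/card_le1_eqP => x y; rewrite !inE => /and3P[_ lx l'x] /and3P[_ ly l'y].
  exact: (inc_unique ne).
rewrite sum1_card -mulnn -cardsX; apply/subset_leq_card/subsetP => ll.
by rewrite inE => /andP[].
Qed.

(** Two points share at most one line, so [s^2 <= n (s + m^2)] with [n = #|L|]. If [s > 2n], then
    [n s < s^2 / 2] and [n m^2 <= (m r)^2 / 4 <= s^2 / 4], a contradiction. *)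
Lemma very_rich_le L r : (4 * #|L| <= r ^ 2)%N -> (#|rich L r| * r <= 2 * #|L|)%N.
Proof.
move=> Lr; set m := #|rich L r|.
pose s := (\sum_(x in rich L r) #|[set l in L | inc l x]|)%N.
have ms : (m * r <= s)%N.
  by rewrite -sum_nat_const; apply: leq_sum => x; rewrite inE.
have s2 : (s ^ 2 <= #|L| * (s + m ^ 2))%N.
  rewrite -[X in (s + X)%N]mul1n.
  apply: (incidences_sqr_le (e := fun x l => inc l x)) => // x y _ _ xy; apply/card_le1_eqP => l l'.
  rewrite !inE => /and3P[_ lx ly] /and3P[_ l'x l'y].
  by apply: contraNeq xy => ll'; apply/eqP; apply: (inc_unique ll' l'x lx l'y ly).
rewrite leqNgt; apply/negP => /leq_trans /(_ ms) big.
have mr : ((m * r) ^ 2 <= s ^ 2)%N by rewrite leq_exp2r.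
have h1 : (4 * #|L| * m ^ 2 <= r ^ 2 * m ^ 2)%N by rewrite leq_mul2r Lr orbT.
have h2 : ((2 * #|L|).+1 * s <= s * s)%N by rewrite leq_mul2r big orbT.
clearbody m s; move: h1 h2 s2 mr; rewrite expnMn -mulnn mulnDr; lia.
Qed.

Lemma rich_sub L L' r x : x \in rich L r ->
  lines_through L x \subset L' -> x \in rich L' r.
Proof.
rewrite !inE => h sub; apply: leq_trans h _; apply/subset_leq_card/subsetP => l lx.
by rewrite inE (subsetP sub) //; move: lx; rewrite inE => /andP[].
Qed.


(** * The induction on the number of lines *)

Section IncidenceInduction.
Variables (R : realFieldType) (SS : {set {set T}}) (theta : nat -> R) (B0 D1 F0 M : nat).
Hypothesis SS_meet : forall Z1 Z2, Z1 \in SS -> Z2 \in SS -> Z1 != Z2 ->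
  (#|Z1 :&: Z2| <= B0)%N.
Hypothesis partition : forall X : {set Pt},
  exists (Y : {set Pt}) (color : Pt -> {set Pt}) (Zs : seq ({set Pt} * {set T})),
  [/\ Y \subset X,
      forall a, a \in Y -> (#|[set b in Y | color b == color a]| * M <= #|X|)%N,
      forall l, (#|[set color a | a in [set a in Y | inc l a]]| <= D1)%N,
      (size Zs <= F0)%N /\
      (forall a, a \in X -> a \notin Y -> exists2 w, w \in Zs & a \in w.1) &
      forall w, w \in Zs -> w.2 \in SS /\ forall l, l \notin w.2 ->
        (#|[set a in w.1 | inc l a]| <= D1)%N].
Hypothesis D1_gt0 : (0 < D1)%N.
Hypothesis D1_lt_M : (4 * D1 < M)%N.
Hypothesis theta_ge0 : forall n, 0 <= theta n.
Hypothesis theta_sqr : forall n, n%:R <= theta n ^+ 2.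
Hypothesis theta_sqr_meet : forall n, (2 * B0 * n)%:R <= theta n ^+ 2.
(** A line meets at most [D1] cells, so the inductive bounds for cells with at most a share
    [4 * D1 / M] of the lines add up to a quarter of the bound for all lines. *)
Hypothesis theta_scale : forall m n, (m * M <= 4 * D1 * n)%N ->
  (4 * D1)%:R * theta m <= theta n.

Definition popular L := [set Z in SS | theta #|L| <= #|Z :&: L|%:R].

(* The rich points not accounted for by one surface containing many of the lines: these are
   the points which Guth's induction on the number of lines bounds. *)
Definition sparse_rich L r :=
  rich L r :\: \bigcup_(Z in popular L) rich (Z :&: L) r./2.+1.

(** With [k] popular surfaces, [k * theta <= s] and [theta ^ 2 >= 2 * B0 * n] give
    [B0 * n * k^2 <= s^2 / 2]; the incidence inequality then leaves [s^2 / 2 <= n * s]. *)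
Lemma sum_popular_le L : (\sum_(Z in popular L) #|Z :&: L| <= 2 * #|L|)%N.
Proof.
set s := (\sum_(Z in _) _)%N; set k := #|popular L|.
have s2 : (s ^ 2 <= #|L| * (s + B0 * k ^ 2))%N.
  apply: (incidences_sqr_le (e := fun (Z : {set T}) l => l \in Z)).
    move=> Z1 Z2; rewrite !inE => /andP[Z1S _] /andP[Z2S _] ne.
    apply: leq_trans (SS_meet Z1S Z2S ne); apply/subset_leq_card/subsetP => l.
    by rewrite !inE => /andP[_].
  by apply: eq_bigr => Z _; apply: eq_card => l; rewrite !inE andbC.
have ks : k%:R * theta #|L| <= s%:R.
  rewrite /s natr_sum mulr_natl -sumr_const; apply: ler_sum => Z.
  by rewrite inE => /andP[].
have h : (2 * B0 * #|L| * k ^ 2 <= s ^ 2)%N.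
  rewrite -(ler_nat R) natrM !natrX.
  apply: le_trans (_ : theta #|L| ^+ 2 * k%:R ^+ 2 <= _).
    by apply: ler_wpM2r (theta_sqr_meet _); rewrite sqr_ge0.
  by rewrite -exprMn mulrC; apply: lerXn2r; rewrite ?nnegrE ?mulr_ge0.
clearbody s k; move: s2 h; rewrite -!mulnn mulnDr => s2 h.
have [->//|s0] := posnP s.
rewrite -(leq_pmul2r s0); lia.
Qed.

(** A counted point has at most [r./2] lines in [Z], so at least [r - r./2] outside, and each of
    these meets [W] at most [D1] times. *)
Lemma many_lines_off_le (Z : {set T}) (W : {set Pt}) L r :
  (forall l, l \notin Z -> (#|[set a in W | inc l a]| <= D1)%N) ->
  (#|(W :&: rich L r) :\: rich (Z :&: L) r./2.+1| * r <= 2 * (D1 * #|L|))%N.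
Proof.
move=> ZW; set Q := _ :\: _.
have : (#|Q| * (r - r./2) <= D1 * #|L|)%N.
  apply: leq_trans (_ : \sum_(a in Q) #|[set l in L :\: Z | inc l a]| <= _)%N.
    rewrite -sum_nat_const; apply: leq_sum => a.
    rewrite !inE -leqNgt => /and3P[h1 _ h2].
    have : (#|lines_through L a| <= #|lines_through (Z :&: L) a|
             + #|[set l in L :\: Z | inc l a]|)%N.
      apply: leq_trans (leq_card_setU _ _); apply/subset_leq_card/subsetP => l.
      by rewrite !inE => /andP[-> ->]; rewrite !andbT orbN.
    by lia.
  rewrite (sum_degrees (fun a l => inc l a)).
  apply: leq_trans (_ : \sum_(l in L :\: Z) D1 <= _)%N.
    apply: leq_sum => l; rewrite inE => /andP[lZ _].
    apply: leq_trans (ZW l lZ); apply/subset_leq_card/subsetP => a.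
    by rewrite !inE => /andP[/and3P[_ -> _] ->].
  by rewrite sum_nat_const mulnC leq_mul2l subset_leq_card ?orbT // subsetDl.
have : (r <= 2 * (r - r./2))%N by have := odd_double_half r; lia.
clearbody Q; nia.
Qed.

(** With [h = r./2 >= 1], the factor 5 comes from [r^2 <= (2h + 1)^2 <= 5 h (h + 1)]. *)
Lemma half_rich_le L r : (2 <= r)%N -> (r ^ 2 * #|rich L r./2.+1| <= 5 * #|L| ^ 2)%N.
Proof.
move=> r2; have := rich_pairs L r./2; set m := #|rich _ _|; set n := (#|L| ^ 2)%N.
have [h1 h2] : (0 < r./2)%N /\ (r <= r./2.*2.+1)%N.
  by have := odd_double_half r; lia.
clearbody m n; move: r./2 h1 h2 => h h1 h2 H.
have : (r ^ 2 <= 5 * (h.+1 * h))%N.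
  apply: leq_trans (_ : (h.*2.+1) ^ 2 <= _)%N; first by rewrite leq_exp2r.
  by rewrite -mulnn; nia.
move=> /(leq_mul (leqnn m)) H2; rewrite mulnC; apply: leq_trans H2 _.
by rewrite mulnCA leq_mul2l H orbT.
Qed.

Lemma richS L L' r : L \subset L' -> rich L r \subset rich L' r.
Proof.
move=> /subsetP LL'; apply/subsetP => x xr; apply: (rich_sub xr).
by apply/subsetP => l; rewrite inE => /andP[/LL'].
Qed.

(** For [x = r^2 * #|X|] and [n = #|L|], [cells_le], [off_cells_le] and [r <= 2 * theta n] give
    [3 x <= (4 * C1 + K) * n * theta n]; the induction closes with [K = 2 * C1]. *)
Let C1 := (14 * D1 + 5 * F0 + 4 * F0 * D1)%N.
Definition induction_constant := (2 * C1)%N.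
Let K := induction_constant%:R : R.

(** A point of [W] not sparse for [L'] is rich within a surface popular for [L'] but not for [L].
    Such a surface has fewer than [theta #|L|] lines, so [half_rich_le] is linear in [#|Z :&: L'|],
    and these sizes sum to at most [2 * #|L'|]. When [r^2] exceeds [4 * #|L'|], no induction is
    called for. *)
Lemma good_cell_le L L' r (W : {set Pt}) :
  (2 <= r)%N -> L' \subset L -> (#|L'| * M <= 4 * D1 * #|L|)%N -> (0 < #|L|)%N ->
  W \subset sparse_rich L r -> W \subset rich L' r ->
  ((r ^ 2 <= 4 * #|L'|)%N -> (#|L'| < #|L|)%N ->
    (r ^ 2 * #|sparse_rich L' r|)%:R <= K * #|L'|%:R * theta #|L'|) ->
  (4 * D1)%:R * (r ^ 2 * #|W|)%:R <=
    #|L'|%:R * ((4 * D1)%:R * (2 * r%:R + 10 * theta #|L|) + K * theta #|L|).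
Proof.
move=> r2 L'L good L0 /subsetP WX WL' IH.
have K0 : 0 <= K by [].
have th0 := theta_ge0 #|L|; have th0' := theta_ge0 #|L'|.
have [very|] := leqP (4 * #|L'|) (r ^ 2).
  have h : (r ^ 2 * #|W| <= 2 * r * #|L'|)%N.
    have := very_rich_le very; have := subset_leq_card WL'.
    move: #|rich L' r| #|W| #|L'| => a b c h1 h2; nia.
  apply: le_trans (_ : (4 * D1)%:R * (2 * r * #|L'|)%:R <= _).
    by rewrite ler_wpM2l // ler_nat.
  rewrite mulrDr mulrDr !natrM.
  have : 0 <= #|L'|%:R * (K * theta #|L|) by rewrite !mulr_ge0.
  have : 0 <= #|L'|%:R * (4%:R * D1%:R * (10 * theta #|L|)) :> R by rewrite !mulr_ge0.
  nra.
move=> /ltnW small.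
have lt_L : (#|L'| < #|L|)%N.
  have := leq_ltn_trans good (_ : _ < M * #|L|)%N.
  rewrite ltn_pmul2r // => /(_ D1_lt_M); rewrite mulnC ltn_pmul2l //.
  exact: leq_trans D1_lt_M.
have {IH}IH := IH small lt_L.
pose Q := [set Z in popular L' | Z \notin popular L].
have sub : W \subset sparse_rich L' r :|: \bigcup_(Z in Q) rich (Z :&: L') r./2.+1.
  apply/subsetP => x xW; rewrite in_setU; case: (boolP (x \in sparse_rich L' r)) => //=.
  rewrite in_setD (subsetP WL') // andbT negbK => /bigcupP [Z Zpop xZ].
  apply/bigcupP; exists Z => //; rewrite in_set Zpop /=; apply/negP => ZpopL.
  move: (WX x xW); rewrite in_setD => /andP[/bigcupP nx _]; apply: nx; exists Z => //.
  by apply: (subsetP (richS _ _)) xZ; apply: setIS.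
have cW : (#|W| <= #|sparse_rich L' r| + \sum_(Z in Q) #|rich (Z :&: L') r./2.+1|)%N.
  apply: leq_trans (subset_leq_card sub) _; apply: leq_trans (leq_card_setU _ _) _.
  rewrite leq_add2l; elim/big_rec2: _ => [|Z m E _ h]; first by rewrite cards0.
  by apply: leq_trans (leq_card_setU _ _) _; rewrite leq_add2l.
have sQ : (r ^ 2 * \sum_(Z in Q) #|rich (Z :&: L') r./2.+1|)%:R <= 10 * theta #|L| * #|L'|%:R.
  rewrite big_distrr /=.
  apply: le_trans (_ : \sum_(Z in Q) 5 * theta #|L| * #|Z :&: L'|%:R <= _).
    rewrite natr_sum; apply: ler_sum => Z; rewrite inE => /andP[Zp Znp].
    apply: le_trans (_ : (5 * #|Z :&: L'| ^ 2)%:R <= _); first by rewrite ler_nat half_rich_le.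
    rewrite natrM natrX expr2 mulrA ler_wpM2r // ler_wpM2l //.
    have ZS : Z \in SS by move: Zp; rewrite inE => /andP[].
    move: Znp; rewrite inE ZS /= -ltNge => /ltW; apply: le_trans.
    by rewrite ler_nat; apply/subset_leq_card/setIS.
  rewrite -mulr_sumr -natr_sum.
  have : (\sum_(Z in Q) #|Z :&: L'| <= 2 * #|L'|)%N.
    apply: leq_trans (sum_popular_le L'); rewrite [X in (_ <= X)%N](bigID (mem Q)) /=.
    apply: leq_trans (leq_addr _ _); apply: eq_leq; apply: eq_bigl => Z.
    by rewrite !inE; case: (Z \in SS); case: (theta #|L'| <= _).
  rewrite -(ler_nat R) natrM => h; have : 0 <= 5 * theta #|L| by rewrite mulr_ge0.
  nra.
have tot : (r ^ 2 * #|W|)%:R <= K * #|L'|%:R * theta #|L'| + 10 * theta #|L| * #|L'|%:R.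
  apply: le_trans (lerD IH sQ); rewrite -natrD ler_nat -mulnDr.
  by rewrite leq_mul2l cW orbT.
have := theta_scale good => sc.
apply: le_trans (_ : (4 * D1)%:R * (K * #|L'|%:R * theta #|L'| + 10 * theta #|L| * #|L'|%:R) <= _).
  by rewrite ler_wpM2l.
have : K * #|L'|%:R * ((4 * D1)%:R * theta #|L'|) <= K * #|L'|%:R * theta #|L|.
  by rewrite ler_wpM2l // mulr_ge0.
have : 0 <= #|L'|%:R * ((4 * D1)%:R * (2 * r%:R)) :> R by rewrite !mulr_ge0.
lra.
Qed.

(** Cells with more than [4 * D1 * #|L| / M] lines number at most [M / 4], and each has at most
    [#|X| / M] points: together they hold a quarter of [X]. The others are summed with
    [good_cell_le]. *)
Lemma cells_le (X Y : {set Pt}) (color : Pt -> {set Pt}) L r :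
  Y \subset X -> X = sparse_rich L r ->
  (forall a, a \in Y -> (#|[set b in Y | color b == color a]| * M <= #|X|)%N) ->
  (forall l, (#|[set color a | a in [set a in Y | inc l a]]| <= D1)%N) ->
  (2 <= r)%N -> (0 < #|L|)%N ->
  (forall L', (r ^ 2 <= 4 * #|L'|)%N -> (#|L'| < #|L|)%N ->
    (r ^ 2 * #|sparse_rich L' r|)%:R <= K * #|L'|%:R * theta #|L'|) ->
  (4 * (r ^ 2 * #|Y|))%:R <= (r ^ 2 * #|X|)%:R +
    (#|L| * D1)%:R * (8 * r%:R + 40 * theta #|L|) + K * #|L|%:R * theta #|L|.
Proof.
move=> YX XE Ycell Yline r2 L0 IH.
pose CC := [set color a | a in Y]; pose cellC C := [set b in Y | color b == C].
pose LC C := [set l in L | [exists a in cellC C, inc l a]].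
have sumLC : (\sum_(C in CC) #|LC C| <= D1 * #|L|)%N.
  rewrite (sum_degrees (fun C l => [exists a in cellC C, inc l a])).
  apply: leq_trans (_ : \sum_(l in L) D1 <= _)%N; last by rewrite sum_nat_const mulnC.
  apply: leq_sum => l _; apply: leq_trans (Yline l); apply/subset_leq_card/subsetP => C.
  rewrite inE => /andP[_ /exists_inP [a + la]]; rewrite inE => /andP[aY /eqP <-].
  by apply: imset_f; rewrite inE aY.
have sumY : #|Y| = (\sum_(C in CC) #|cellC C|)%N.
  rewrite -sum1_card (partition_big color (mem CC)) /=; last first.
    by move=> a aY; apply: imset_f.
  apply: eq_bigr => C _; rewrite sum1dep_card; apply: eq_card => a.
  by rewrite !inE.
have cellM C : C \in CC -> (#|cellC C| * M <= #|X|)%N.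
  by move=> /imsetP[a aY ->]; apply: Ycell.
have M0 : (0 < M)%N by apply: leq_trans D1_lt_M.
pose good C := (#|LC C| * M <= 4 * D1 * #|L|)%N.
have bad_le : (4 * \sum_(C in CC | ~~ good C) #|cellC C| <= #|X|)%N.
  pose b := #|[set C in CC | ~~ good C]|.
  have b4 : (4 * b <= M)%N.
    have : (b * (4 * D1 * #|L|) <= D1 * #|L| * M)%N.
      apply: leq_trans (_ : (\sum_(C in CC) #|LC C|) * M <= _)%N; last first.
        by rewrite leq_mul2r sumLC orbT.
      rewrite big_distrl /= (bigID good) /=; apply: leq_trans (leq_addl _ _).
      rewrite /b -sum_nat_const (eq_bigl (fun C => (C \in CC) && ~~ good C)); last first.
        by move=> C; rewrite inE.
      by apply: leq_sum => C /andP[_]; rewrite -ltnNge => /ltnW.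
    have : (0 < D1 * #|L|)%N by rewrite muln_gt0 D1_gt0.
    have -> : (b * (4 * D1 * #|L|) = D1 * #|L| * (4 * b))%N by ring.
    by move=> /leq_pmul2l ->.
  rewrite -(leq_pmul2r M0) -mulnA big_distrl /=.
  apply: leq_trans (_ : 4 * (b * #|X|) <= _)%N.
    rewrite leq_mul2l /= /b -sum_nat_const.
    rewrite [X in (_ <= X)%N](eq_bigl (fun C => (C \in CC) && ~~ good C)); last first.
      by move=> C; rewrite inE.
    by apply: leq_sum => C /andP[/cellM].
  by rewrite mulnA [X in (_ <= X)%N]mulnC leq_mul2r b4 orbT.
set th := theta #|L|; have th0 : 0 <= th by apply: theta_ge0.
have K0 : 0 <= K by [].
have good_le : (4 * D1)%:R * (\sum_(C in CC | good C) r ^ 2 * #|cellC C|)%:R <=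
    (D1 * #|L|)%:R * ((4 * D1)%:R * (2 * r%:R + 10 * th) + K * th).
  rewrite natr_sum mulr_sumr.
  apply: le_trans (_ : \sum_(C in CC | good C) #|LC C|%:R *
     ((4 * D1)%:R * (2 * r%:R + 10 * th) + K * th) <= _).
    apply: ler_sum => C /andP[CCC gC].
    have cellX : cellC C \subset sparse_rich L r.
      by rewrite -XE; apply: subset_trans YX; apply/subsetP => a; rewrite inE => /andP[].
    apply: good_cell_le => //.
    - by apply/subsetP => l; rewrite inE => /andP[].
    - apply/subsetP => a aC; apply: (rich_sub (L := L)).
        by have := subsetP cellX a aC; rewrite in_setD => /andP[].
      apply/subsetP => l; rewrite !inE => /andP[-> la] /=.
      by apply/exists_inP; exists a.
    - exact: IH.
  rewrite -mulr_suml -natr_sum ler_wpM2r //.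
    by rewrite addr_ge0 ?mulr_ge0 ?addr_ge0 ?mulr_ge0.
  rewrite ler_nat; apply: leq_trans sumLC; rewrite [X in (_ <= X)%N](bigID good) /=.
  exact: leq_addr.
have -> : (4 * (r ^ 2 * #|Y|))%:R = (r ^ 2)%:R * (4 * \sum_(C in CC | ~~ good C) #|cellC C|)%:R
   + 4 * (\sum_(C in CC | good C) r ^ 2 * #|cellC C|)%:R :> R.
  rewrite sumY (bigID good) /= -big_distrr /= !natrM natrD; ring.
have h1 : (r ^ 2)%:R * (4 * \sum_(C in CC | ~~ good C) #|cellC C|)%:R <= (r ^ 2 * #|X|)%:R :> R.
  by rewrite -natrM ler_nat leq_mul2l bad_le orbT.
have D1R : 0 < D1%:R :> R by rewrite ltr0n.
have h2 : 4 * (\sum_(C in CC | good C) r ^ 2 * #|cellC C|)%:R <=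
    (#|L| * D1)%:R * (8 * r%:R + 40 * th) + K * #|L|%:R * th.
  rewrite -(ler_pM2l D1R); move: good_le.
  move: (\sum_(C in CC | good C) _)%N => G; rewrite !natrM => H.
  apply: le_trans (le_trans _ H) _; first by rewrite le_eqVlt; apply/orP; left; apply/eqP; ring.
  by rewrite le_eqVlt; apply/orP; left; apply/eqP; ring.
by rewrite -addrA lerD.
Qed.

(** On a popular surface the sparse points have many lines off it; a surface that is not popular has
    few lines, and the points half rich within it are bounded by [half_rich_le]. *)
Lemma off_cells_le (X : {set Pt}) (w : {set Pt} * {set T}) L r :
  X = sparse_rich L r -> w.2 \in SS ->
  (forall l, l \notin w.2 -> (#|[set a in w.1 | inc l a]| <= D1)%N) ->
  (2 <= r)%N ->
  (r ^ 2 * #|X :&: w.1|)%:R <= 5 * #|L|%:R * theta #|L| + 2 * r%:R * (D1 * #|L|)%:R.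
Proof.
move=> XE wSS wl r2.
have h := many_lines_off_le L r wl; set Q := _ :\: _ in h.
have hQ : (r ^ 2 * #|Q|)%:R <= 2 * r%:R * (D1 * #|L|)%:R :> R.
  rewrite -natrM -natrM ler_nat -mulnn -mulnA [(r * #|Q|)%N]mulnC -[(2 * r)%N]mulnC -mulnA.
  by rewrite leq_mul2l h orbT.
have th0 := theta_ge0 #|L|.
case: (boolP (w.2 \in popular L)) => pop.
  apply: le_trans (_ : (r ^ 2 * #|Q|)%:R <= _).
    rewrite ler_nat leq_mul2l; apply/orP; right; apply/subset_leq_card/subsetP => a.
    rewrite XE !in_setI /Q !in_setD => /andP[/andP[/bigcupP na ra] wa].
    by rewrite in_setI wa ra andbT /= andbT; apply/negP => aw; apply: na; exists w.2.
  by apply: le_trans hQ _; rewrite lerDr !mulr_ge0.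
have lt_th : #|w.2 :&: L|%:R <= theta #|L|.
  by move: pop; rewrite inE wSS /= -ltNge => /ltW.
apply: le_trans (_ : (r ^ 2 * #|rich (w.2 :&: L) r./2.+1|)%:R + (r ^ 2 * #|Q|)%:R <= _).
  rewrite -natrD ler_nat -mulnDr leq_mul2l; apply/orP; right.
  apply: leq_trans (leq_card_setU _ _); apply/subset_leq_card/subsetP => a.
  rewrite XE /Q !(in_setU, in_setD, in_setI) => /andP[/andP[_ ra] wa].
  by rewrite wa ra /= andbT orbN.
apply: lerD => //; apply: le_trans (_ : (5 * #|w.2 :&: L| ^ 2)%:R <= _).
  by rewrite ler_nat half_rich_le.
rewrite -mulnn !natrM -mulrA ler_wpM2l // ler_pM //.
by rewrite ler_nat subset_leq_card // subsetIr.
Qed.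

Lemma sparse_rich_le L r : (2 <= r)%N -> (r ^ 2 <= 4 * #|L|)%N ->
  (r ^ 2 * #|sparse_rich L r|)%:R <= K * #|L|%:R * theta #|L|.
Proof.
have [n] := ubnP #|L|; elim: n L => // n IHn L; rewrite ltnS => Ln r2 rL.
have L0 : (0 < #|L|)%N.
  by rewrite lt0n; apply: contraTneq rL => ->; rewrite muln0 -ltnNge sqrn_gt0; lia.
have [Y [color [Zs [YX Ycell Yline [sZs Zcov] ZsP]]]] := partition (sparse_rich L r).
set X := sparse_rich L r in YX Ycell Zcov *; set th := theta #|L|.
have cells := cells_le YX erefl Ycell Yline r2 L0
  (fun L' h1 h2 => IHn L' (leq_trans h2 Ln) r2 h1).
have th0 : 0 <= th by apply: theta_ge0.
set c := 5 * #|L|%:R * th + 2 * r%:R * (D1 * #|L|)%:R.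
have c0 : 0 <= c by rewrite addr_ge0 ?mulr_ge0.
have rest : (r ^ 2 * #|X :\: Y|)%:R <= F0%:R * c.
  apply: le_trans (_ : (r ^ 2 * \sum_(w <- Zs) #|X :&: w.1|)%:R <= _).
    rewrite ler_nat leq_mul2l; apply/orP; right.
    apply: leq_trans (_ : #|\bigcup_(w <- Zs) (X :&: w.1)| <= _)%N.
      apply/subset_leq_card/subsetP => a; rewrite in_setD => /andP[aY aX].
      have [w wZs aw] := Zcov a aX aY; rewrite (big_rem w) //= in_setU in_setI aX aw.
      by [].
    elim: (Zs) => [|w s IHs]; first by rewrite !big_nil cards0.
    rewrite !big_cons; apply: leq_trans (leq_card_setU _ _) _.
    by rewrite leq_add2l.
  apply: le_trans (_ : (size Zs)%:R * c <= _); last by rewrite ler_wpM2r // ler_nat.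
  rewrite big_distrr /= natr_sum mulr_natl.
  elim: (Zs) ZsP => [|w s IHs] wP; first by rewrite big_nil mulr0n.
  rewrite big_cons mulrS lerD //.
    have [wSS wl] := wP w (mem_head _ _); exact: (off_cells_le erefl wSS wl r2).
  by apply: IHs => v vs; apply: wP; rewrite inE vs orbT.
have XE : (r ^ 2 * #|X|)%:R = (r ^ 2 * #|Y|)%:R + (r ^ 2 * #|X :\: Y|)%:R :> R.
  by rewrite -natrD -mulnDr -(cardsID Y X) (setIidPr YX).
(* This is where [r ^ 2 <= 4 * #|L|] enters: the terms linear in [r] are absorbed by [theta]. *)
have rth : r%:R <= 2 * th.
  rewrite -(ler_pXn2r (isT : (0 < 2)%N)) ?nnegrE ?mulr_ge0 // exprMn.
  apply: le_trans (_ : (4 * #|L|)%:R <= _); first by rewrite -natrX ler_nat.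
  by rewrite natrM -natrX; apply: ler_wpM2l => //; apply: theta_sqr.
move: cells rest; rewrite /c XE /K /induction_constant /C1.
move: (r ^ 2 * #|Y|)%N (r ^ 2 * #|X :\: Y|)%N => y z.
rewrite !natrM !natrD !natrM -/th; set l := #|L|%:R; set d1 := D1%:R; set f0 := F0%:R.
move=> e1 e2.
have l0 : 0 <= l by []. 
have d0 : 0 <= d1 by [].
have f00 : 0 <= f0 by [].
have p1 : l * d1 * r%:R <= l * d1 * (2 * th) by rewrite ler_wpM2l ?mulr_ge0.
have p2 : f0 * l * d1 * r%:R <= f0 * l * d1 * (2 * th) by rewrite ler_wpM2l ?mulr_ge0.
nra.
Qed.

End IncidenceInduction.

End RichPoints.

(** * Choice of the degree; powers and logarithms *)

Section ExponentArithmetic.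
Variable R : realType.
Local Notation expR := sequences.expR.

(** Squaring [y <= expR y] at [y = s * e / 2] gives a quadratic lower bound in [e]. *)
Lemma linear_le_exponential (s : R) (b : nat) : 0 < s ->
  exists2 e : nat, (0 < e)%N & (b * e)%:R <= expR (s * e%:R).
Proof.
move=> s0; have c0 : 0 <= 4 * b%:R / s ^+ 2.
  by apply: divr_ge0; [apply: mulr_ge0 | apply: sqr_ge0].
exists (Num.bound (4 * b%:R / s ^+ 2)).+1 => //; set e := _.+1.
have eb : 4 * b%:R / s ^+ 2 <= e%:R.
  by apply: le_trans (ltW (archi_boundP c0)) _; rewrite ler_nat leqnSn.
rewrite ler_pdivrMr ?exprn_gt0 // in eb.
have -> : s * e%:R = s * e%:R / 2 + s * e%:R / 2 by lra.
rewrite expRD -expr2.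
have y0 : 0 <= s * e%:R / 2 by rewrite divr_ge0 // mulr_ge0 // ltW.
have h : s * e%:R / 2 <= expR (s * e%:R / 2).
  by apply: le_trans (expR_ge1Dx _); lra.
apply: le_trans (_ : (s * e%:R / 2) ^+ 2 <= _); last first.
  by rewrite lerXn2r ?nnegrE ?expR_ge0.
have -> : (s * e%:R / 2) ^+ 2 = e%:R * (e%:R * s ^+ 2) / 4 :> R by field.
rewrite natrM ler_pdivlMr //.
have : e%:R * (4 * b%:R) <= e%:R * (e%:R * s ^+ 2) :> R by rewrite ler_wpM2l.
by apply: le_trans; rewrite le_eqVlt; apply/orP; left; apply/eqP; ring.
Qed.

Lemma partition_parameters (eps : R) : 0 < eps -> exists d M k : nat,
  let a := (4 * (3 * d * k.+1).+1)%N in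
  [/\ (0 < M <= d.+1 ^ 3)%N, (M ^ 2 * 2 ^ k <= 3 ^ k)%N, (a < M)%N &
     a%:R * (a%:R / M%:R) `^ (2^-1 + eps) <= 1 :> R].
Proof.
move=> eps0; set p := 2^-1 + eps; have p0 : 0 < p by rewrite /p; lra.
have l2 : 0 < ln 2 :> R by apply: ln_gt0; rewrite ltr1n.
(* Taking logarithms, the last condition follows from [(1 + p) * ln (160 * e) <= (2 * p - 1) * e *
   ln 2], and [2 * p - 1 = 2 * eps]. *)
pose s : R := 2 * eps * ln 2 / (1 + p).
have p1 : 0 < 1 + p by lra.
have s0 : 0 < s by apply: divr_gt0 => //; rewrite !mulr_gt0.
have [e e0 he] := linear_le_exponential 160 s0.
(* Thus [M = d.+1 ^ 3], and the condition on [k] reads [8 ^ (6 * e) <= 9 ^ (6 * e)]. The 160 bounds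
   [12 * 13 + 4]. *)
exists (2 ^ e).-1, (2 ^ (3 * e))%N, (12 * e)%N => a.
have pw0 : (0 < 2 ^ e)%N by rewrite expn_gt0.
have aA : (a <= 160 * e * 2 ^ e)%N.
  rewrite /a; move: (2 ^ e)%N pw0 => w w0; rewrite -subn1.
  have [e' eE] : exists e', e = e'.+1 by exists e.-1; rewrite prednK.
  have [w' wE] : exists w', w = w'.+1 by exists w.-1; rewrite prednK.
  by rewrite eE wE subn1 /=; nia.
have a4 : (4 <= a)%N by rewrite /a; lia.
have a0 : 0 < a%:R :> R by rewrite ltr0n; lia.
have M0 : 0 < (2 ^ (3 * e))%:R :> R by rewrite ltr0n expn_gt0.
have main : a%:R * (a%:R / (2 ^ (3 * e))%:R) `^ p <= 1 :> R.
  have u0 : 0 < (160 * e)%:R :> R by rewrite ltr0n; lia.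
  have w0 : 0 < (2 ^ e)%:R :> R by rewrite ltr0n.
  have lna : ln a%:R <= ln (160 * e)%:R + e%:R * ln 2 :> R.
    have -> : e%:R * ln 2 = ln (2 ^ e)%:R :> R by rewrite natrX lnXn // mulr_natl.
    rewrite -lnM ?posrE // -natrM ler_ln ?posrE ?ler_nat // ltr0n.
    by apply: leq_trans (leq_trans _ a4) aA.
  have lnu : ln (160 * e)%:R <= s * e%:R.
    by rewrite -[s * _]expRK ler_ln ?posrE ?expR_gt0.
  have lnM' : ln (2 ^ (3 * e))%:R = 3 * e%:R * ln 2 :> R.
    by rewrite natrX lnXn // -[LHS]mulr_natl natrM.
  rewrite -[X in X * _](lnK (x := a%:R)) ?posrE //.
  rewrite /powR gt_eqF ?divr_gt0 // ln_div ?posrE // -expRD expR_le1 lnM'.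
  have : (1 + p) * ln a%:R <= (1 + p) * (s * e%:R + e%:R * ln 2).
    by rewrite ler_pM2l //; apply: le_trans lna _; rewrite lerD2r.
  have : (1 + p) * s = 2 * eps * ln 2 by rewrite /s mulrC divfK // gt_eqF.
  have -> : (1 + p) * (s * e%:R + e%:R * ln 2) = (1 + p) * s * e%:R + (1 + p) * (e%:R * ln 2).
    by ring.
  move=> ->; rewrite /p; set x := e%:R * ln 2; set y := ln a%:R.
  have -> : 3 * e%:R * ln 2 = 3 * x by rewrite /x; ring.
  have -> : 2 * eps * ln 2 * e%:R = 2 * eps * x by rewrite /x; ring.
  lra.
split=> //.
- by rewrite expn_gt0 /= prednK // -expnM mulnC.
- rewrite -expnM -expnD.
  have -> : (3 * e * 2 + 12 * e = 3 * (6 * e))%N by lia.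
  have -> : (12 * e = 2 * (6 * e))%N by lia.
  by rewrite (expnM 2 3) (expnM 3 2) leq_exp2r // muln_gt0.
- rewrite ltnNge; apply/negP => Ma; move: main; apply/negP; rewrite -ltNge.
  have h : 1 <= (a%:R / (2 ^ (3 * e))%:R) `^ p.
    have e1 : 1 `^ p = 1 :> R by rewrite powR1.
    rewrite -[X in X <= _]e1; apply: ge0_ler_powR.
    + exact: ltW.
    + by rewrite nnegrE.
    + by rewrite nnegrE divr_ge0.
    + by rewrite ler_pdivlMr // mul1r ler_nat.
  apply: lt_le_trans (_ : a%:R * 1 <= _); last by rewrite ler_pM2l.
  by rewrite mulr1 ltr1n; lia.
Qed.

Lemma harmonic_le (n : nat) : \sum_(1 <= r < n.+2) r%:R^-1 <= 1 + ln n.+1%:R :> R.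
Proof.
elim: n => [|n IHn]; first by rewrite big_nat1 ln1 addr0 invr1.
rewrite big_nat_recr //=; apply: le_trans (lerD IHn (lexx _)) _.
rewrite -addrA lerD2l.
have p1 : 0 < n.+1%:R :> R by rewrite ltr0n.
have p2 : 0 < n.+2%:R :> R by rewrite ltr0n.
have : ln (1 + - n.+2%:R^-1) <= - n.+2%:R^-1 :> R.
  by apply: le_ln1Dx; rewrite ltrN2 invf_lt1 // ltr1n.
have -> : 1 + - n.+2%:R^-1 = n.+1%:R / n.+2%:R :> R.
  have e : n.+2%:R = n.+1%:R + 1 :> R by rewrite natr1.
  by rewrite e in p2 *; apply: (mulIf (lt0r_neq0 p2));
    rewrite divfK ?lt0r_neq0 // mulrDl mulNr mulVf ?lt0r_neq0 // mul1r addrK.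
rewrite ln_div ?posrE //; move: (ln _) (ln _) (n.+2%:R^-1) => a b c; lra.
Qed.

Lemma ln_le_powR (eps x : R) : 0 < eps -> 1 <= x -> ln x <= eps^-1 * x `^ eps.
Proof.
move=> eps0 x1; have x0 : 0 < x by apply: lt_le_trans x1.
rewrite ler_pdivlMl // -ln_powR.
by apply/ltW/ln_sublinear/powR_gt0.
Qed.

End ExponentArithmetic.

(** * Rich points of the lines of rotations *)

Section RigidMotionIncidences.
Variables (R : realType) (P : finType) (pos : P -> R * R).
Hypothesis pos_inj : injective pos.
Variables (Pt : finType) (px py pt : Pt -> R).
Hypothesis loc_inj : injective (fun a => (px a, py a, pt a)).

Local Notation T := (P * P)%type.

Definition motion_x (l : T) := line_x (pos l.1) (pos l.2).
Definition motion_y (l : T) := line_y (pos l.1) (pos l.2).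
Let inc := incident px py pt motion_x motion_y.

Lemma size_linear_le2 (a b : R) : (size (a%:P + b%:P * 'X)%R <= 2)%N.
Proof.
apply: leq_trans (size_polyD _ _) _; rewrite geq_max; apply/andP; split.
  by apply: leq_trans (size_polyC_leq1 _) _.
rewrite mul_polyC; apply: leq_trans (size_scale_leq _ _) _.
by rewrite size_polyX.
Qed.

Lemma size_motion_x l : (size (motion_x l) <= 2)%N.
Proof. exact: size_linear_le2. Qed.

Lemma size_motion_y l : (size (motion_y l) <= 2)%N.
Proof. by rewrite /motion_y /line_y -mulNr -polyCN; apply: size_linear_le2. Qed.

Lemma motion_inj : injective (fun l => (motion_x l, motion_y l)).
Proof. by move=> [p q] [p' q'] [/line_inj h /h [/pos_inj -> /pos_inj ->]]. Qed.

Lemma incidentP l a : reflect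
  ((pos l.1).1 + (pos l.2).1 + ((pos l.1).2 - (pos l.2).2) * pt a = px a /\
   (pos l.1).2 + (pos l.2).2 - ((pos l.1).1 - (pos l.2).1) * pt a = py a) (inc l a).
Proof.
rewrite /inc /incident /motion_x /motion_y /line_x /line_y !hornerE /=.
by apply: (iffP andP) => [[/eqP-> /eqP->]|[-> ->]].
Qed.

Lemma linear_eq (f g : {poly R}) s t : (size f <= 2)%N -> (size g <= 2)%N -> s != t ->
  f.[s] = g.[s] -> f.[t] = g.[t] -> f = g.
Proof.
move=> sf sg st fgs fgt; apply/eqP; rewrite -subr_eq0; apply/negPn/negP => h0.
have /(_ [:: s; t]) h := max_poly_roots h0.
have : (2 < size (f - g)%R)%N.
  apply: h; first by rewrite /= !rootE !hornerE fgs fgt !subrr eqxx.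
  by rewrite /= inE st.
rewrite ltnNge => /negP; apply; apply: leq_trans (size_polyD _ _) _.
by rewrite geq_max sf size_polyN sg.
Qed.

Lemma motion_lines_meet_once l l' a b : l != l' ->
  inc l a -> inc l' a -> inc l b -> inc l' b -> a = b.
Proof.
move=> ll' la l'a lb l'b; apply: (incident_pt_inj loc_inj la lb).
apply: contraNeq ll' => ab; apply/eqP/motion_inj.
move: la l'a lb l'b => /andP[/eqP xa /eqP ya] /andP[/eqP xa' /eqP ya']
  /andP[/eqP xb /eqP yb] /andP[/eqP xb' /eqP yb'].
congr (_, _); apply: (linear_eq (s := pt a) (t := pt b)) => //;
  rewrite ?size_motion_x ?size_motion_y //.
- by rewrite xa xa'.
- by rewrite xb xb'.
- by rewrite ya ya'.
- by rewrite yb yb'.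
Qed.

(** A point is a rotation, so [p] determines [q]: the equations for two candidates give
    [(1 + t^2) (q1 - r1) = 0]. *)
Lemma lines_through_le a : (#|[set l | inc l a]| <= #|P|)%N.
Proof.
rewrite -(card_in_imset (f := fst)); first exact: max_card.
move=> [p q] [p' q']; rewrite !inE => /incidentP /= [h1 h2] /incidentP /= [h3 h4] /= pp'.
rewrite -{}pp' in h3 h4 *; congr (_, _); apply: pos_inj.
move: h1 h2 h3 h4; case: (pos p) (pos q) (pos q') (pt a) => [p1 p2] [q1 q2] [r1 r2] t /=.
move=> h1 h2 h3 h4.
have e1 : q1 - r1 = (q2 - r2) * t by lra.
have e2 : q2 - r2 = - (q1 - r1) * t by lra.
have e3 : q1 - r1 = 0 by nra.
have e4 : q2 - r2 = 0 by rewrite e2 e3; lra.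
by congr (_, _); lra.
Qed.

End RigidMotionIncidences.

Section RichPointBound.
Variable R : realType.

(* [theta n = c n^(1/2+eps)]; the constant [c] is so large that no surface of the
   family contains more than [theta (N^2)] of the [N^2] lines. *)
Theorem rich_motions_le (eps : R) : 0 < eps -> exists2 K : R, 0 < K &
  forall (P : finType) (pos : P -> R * R) (Pt : finType) (px py pt : Pt -> R) (r : nat),
  injective pos -> injective (fun a => (px a, py a, pt a)) ->
  (2 <= r <= #|P|)%N ->
  (r ^ 2 * #|rich (incident px py pt (motion_x pos) (motion_y pos)) [set: P * P] r|)%:R
    <= K * #|P|%:R `^ (3 + 2 * eps).
Proof.
move=> eps0; have [d [M [k]]] := partition_parameters eps0.
set D1 := (3 * d * k.+1).+1 => /= -[Md Mk aM scale].
pose B0 := (2 * d * d * d)%N; pose B1 := (common_zeros_bound d).+1.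
(* [2 * B0] serves [theta_sqr_meet]; [B1 + 1] puts the lines of any one surface strictly below
   [theta (N^2)], so that no surface is popular for the full set of lines. *)
pose c : R := (2 * B0 + B1 + 1)%:R; set p := 2^-1 + eps in scale *.
have p0 : 0 < p by rewrite /p; lra.
pose theta (n : nat) : R := c * n%:R `^ p.
have c1 : 1 <= c by rewrite ler1n addn1.
have c0 : 0 < c by apply: lt_le_trans c1.
have theta0 n : 0 <= theta n by rewrite mulr_ge0 ?powR_ge0 // ltW.
have sqr_ge (b n : nat) : b%:R <= c ^+ 2 -> (b * n)%:R <= theta n ^+ 2.
  move=> bc; rewrite natrM /theta exprMn.
  have [->|n0] := posnP n; first by rewrite mulr0 mulr_ge0 // sqr_ge0.
  apply: ler_pM => //; rewrite -powR_mulrn ?powR_ge0 // -powRrM.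
  by apply: le1r_powR; rewrite ?ler1n // /p; lra.
have csq : c <= c ^+ 2 by rewrite expr2 ler_peMl // ltW.
have theta_sqr n : n%:R <= theta n ^+ 2.
  by rewrite -[n in n%:R]mul1n; apply: sqr_ge; apply: le_trans csq.
have theta_meet n : (2 * B0 * n)%:R <= theta n ^+ 2.
  by apply: sqr_ge; apply: le_trans csq; rewrite ler_nat -addnA leq_addr.
have M0 : 0 < M%:R :> R by rewrite ltr0n; case/andP: Md.
have theta_scale m n : (m * M <= 4 * D1 * n)%N -> (4 * D1)%:R * theta m <= theta n.
  move=> mn; have mle : m%:R <= (4 * D1)%:R / M%:R * n%:R :> R.
    by rewrite mulrAC ler_pdivlMr // -!natrM ler_nat.
  have h1 : m%:R `^ p <= ((4 * D1)%:R / M%:R * n%:R) `^ p.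
    apply: ge0_ler_powR => //; first exact: ltW.
      by rewrite nnegrE.
    by rewrite nnegrE; apply: mulr_ge0 => //; apply: divr_ge0.
  rewrite /theta mulrCA ler_pM2l //.
  apply: le_trans (ler_wpM2l (ler0n _ _) h1) _.
  rewrite powRM ?divr_ge0 // mulrA; apply: ler_piMl => //; exact: powR_ge0.
pose K : R := (induction_constant D1 (3 * d * k))%:R * c.
exists K; first by rewrite mulr_gt0 // ltr0n.
move=> P pos Pt px py pt r posI locI /andP[r2 rP].
set inc := incident _ _ _ _ _.
pose SS := surfaces (motion_x pos) (motion_y pos) d.
have SSmeet Z1 Z2 : Z1 \in SS -> Z2 \in SS -> Z1 != Z2 -> (#|Z1 :&: Z2| <= B0)%N.
  exact: (surfaces_meet (motion_inj posI)).
have part (X : {set Pt}) := lines_partition (lX := motion_x pos) (lY := motion_y pos)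
  locI (size_motion_x pos) (size_motion_y pos) X Md Mk.
have NN : #|[set: P * P]| = (#|P| ^ 2)%N by rewrite cardsT card_prod mulnn.
have := sparse_rich_le (inc := inc) (motion_lines_meet_once posI locI) SSmeet part
  (ltn0Sn _) aM theta0 theta_sqr theta_meet theta_scale (L := [set: P * P]) (r := r) r2.
have rN : (r ^ 2 <= 4 * #|[set: P * P]|)%N.
  by rewrite NN; apply: leq_trans (leq_pmull _ _) => //; rewrite leq_exp2r.
move=> /(_ rN); rewrite /sparse_rich.
have N0 : (0 < #|P|)%N by apply: leq_trans rP; apply: ltnW.
have NR : 1 <= #|P|%:R :> R by rewrite ler1n.
have N2p : #|[set: P * P]|%:R `^ p = #|P|%:R `^ (1 + 2 * eps) :> R.
  by rewrite NN natrX -powR_mulrn // -powRrM; congr (_ `^ _); rewrite /p; lra.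
have -> : popular SS theta [set: P * P] = set0.
  apply/setP => Z; rewrite !inE; apply/negP => /andP[/asboolP [f [firr fD ->]]].
  apply/negP; rewrite -ltNge setIT.
  have /and3P[f1 f2 _] := fD; have := surface_lines_le firr f1 f2 posI => sle.
  apply: le_lt_trans (_ : (B1 * #|P|)%:R < _); first by rewrite ler_nat.
  rewrite /theta N2p natrM.
  apply: lt_le_trans (_ : c * #|P|%:R <= _).
    by rewrite ltr_pM2r ?ltr0n // ltr_nat addn1 ltnS leq_addl.
  by rewrite ler_pM2l //; apply: le1r_powR => //; lra.
rewrite big_set0 setD0 => h; apply: le_trans h _.
rewrite -/D1 /theta N2p NN natrX /K -[X in X <= _]mulrA -[X in _ <= X]mulrA.
rewrite ler_pM2l ?ltr0n // mulrCA ler_pM2l //.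
rewrite -powR_mulrn // -powRD; last first.
  by rewrite pnatr_eq0 -lt0n N0 implybT.
by rewrite le_eqVlt; apply/orP; left; apply/eqP; congr (_ `^ _); lra.
Qed.

End RichPointBound.

(** * Distinct distances *)

Section DistanceEnergy.

Lemma card_sqr_le_collisions (W D : finType) (f : W -> D) :
  (#|W| ^ 2 <= #|D| * #|[set ww : W * W | f ww.1 == f ww.2]|)%N.
Proof.
have sumW : (\sum_(x in [set: D]) #|[set w | f w == x]| = #|W|)%N.
  rewrite -sum1_card (partition_big f predT) //=.
  rewrite (eq_bigl predT) => [|x]; last by rewrite inE.
  by apply: eq_bigr => x _; rewrite sum1dep_card.
rewrite -{1}sumW; apply: leq_trans (sum_sqr_le _ _) _; rewrite cardsT leq_mul2l.
apply/orP; right; rewrite (eq_bigl predT) => [|x]; last by rewrite inE.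
rewrite -[X in (_ <= X)%N]sum1_card (partition_big (fun ww : W * W => f ww.1) predT) //=.
apply: leq_sum => x _; rewrite sum1dep_card -mulnn -cardsX.
apply/subset_leq_card/subsetP => -[w w']; rewrite !inE /= => /andP[/eqP-> /eqP->].
by rewrite eqxx.
Qed.

Variables (R : realType) (P : finType) (pos : P -> R * R).
Hypothesis pos_inj : injective pos.
Local Notation T := (P * P)%type.
Local Notation N := #|P|.

Definition sqr_dist (p q : R * R) : R := (p.1 - q.1) ^+ 2 + (p.2 - q.2) ^+ 2.

(* The time at which two motion lines can meet: the abscissae agree when
   [u1 + v1 + (u2 - v2) t = 0], the ordinates when [u2 + v2 - (u1 - v1) t = 0]. For lines
   that do not meet, [meeting_point] is a junk point of the first line. *)
Definition meeting_time (l l' : T) : R :=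
  let u := ((pos l.1).1 - (pos l'.1).1, (pos l.1).2 - (pos l'.1).2) in
  let v := ((pos l.2).1 - (pos l'.2).1, (pos l.2).2 - (pos l'.2).2) in
  if u.1 == v.1 then - (u.1 + v.1) / (u.2 - v.2) else (u.2 + v.2) / (u.1 - v.1).

Definition meeting_point (ll : T * T) : R * R * R :=
  let t := meeting_time ll.1 ll.2 in
  (((motion_x pos ll.1).[t], (motion_y pos ll.1).[t]), t).

(** A finite type of points that contains a common point of any two congruent, nontranslated
    pairs. *)
Local Notation Pt := (seq_sub (codom meeting_point)).

Let px (a : Pt) := (ssval a).1.1.
Let py (a : Pt) := (ssval a).1.2.
Let pt (a : Pt) := (ssval a).2.
Let inc := incident px py pt (motion_x pos) (motion_y pos).

(** The motion taking one segment to the other is then a translation, and the two lines are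
    parallel. *)
Definition is_translation (ll : T * T) :=
  [&& (pos ll.1.1).1 - (pos ll.2.1).1 == (pos ll.1.2).1 - (pos ll.2.2).1
    & (pos ll.1.1).2 - (pos ll.2.1).2 == (pos ll.1.2).2 - (pos ll.2.2).2].

(** With [u = p - p'] and [v = q - q'], meeting is two linear equations in [t]. Their compatibility
    determinant is [|u|^2 - |v|^2 = 0], and one has a nonzero coefficient since [u] is not [v]. *)
Lemma congruent_pairs_meet (l l' : T) : ~~ is_translation (l, l') ->
  sqr_dist (pos l.1) (pos l'.1) = sqr_dist (pos l.2) (pos l'.2) ->
  exists a, inc l a && inc l' a.
Proof.
move=> ntr sd; pose a : Pt := SeqSub (codom_f meeting_point (l, l')).
exists a; apply/andP; split; first by rewrite /inc /incident /px /py /pt /= !eqxx.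
apply/incidentP; rewrite /px /py /pt /a /= /meeting_time /motion_x /motion_y /line_x /line_y.
rewrite !hornerE /=; move: ntr sd; rewrite /is_translation /sqr_dist /=.
move: (pos l.1) (pos l.2) (pos l'.1) (pos l'.2).
move=> [p1 p2] [q1 q2] [r1 r2] [s1 s2] /= ntr sd.
case: eqP ntr => [e|/eqP ne] /=.
  move=> ne; have d0 : (p2 - r2) - (q2 - s2) != 0 by rewrite subr_eq0.
  set t := _ / _; have tE : t * ((p2 - r2) - (q2 - s2)) = - ((p1 - r1) + (q1 - s1)).
    by rewrite /t divfK // addrA.
  have z : (p2 - r2) + (q2 - s2) = 0.
    apply: (mulfI d0); rewrite mulr0.
    have -> : ((p2 - r2) - (q2 - s2)) * ((p2 - r2) + (q2 - s2)) =
      (p2 - r2) ^+ 2 - (q2 - s2) ^+ 2 by ring.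
    by move: sd; rewrite e => /addrI ->; rewrite subrr.
  split; first lra.
  have -> : r1 - s1 = p1 - q1 by lra.
  lra.
move=> _; have d0 : (p1 - r1) - (q1 - s1) != 0 by rewrite subr_eq0.
set t := _ / _; have tE : t * ((p1 - r1) - (q1 - s1)) = (p2 - r2) + (q2 - s2).
  by rewrite /t divfK // addrA.
have z : (p1 - r1) + (q1 - s1) + ((p2 - r2) - (q2 - s2)) * t = 0.
  apply: (mulfI d0); rewrite mulr0.
  have -> : ((p1 - r1) - (q1 - s1)) * ((p1 - r1) + (q1 - s1) + ((p2 - r2) - (q2 - s2)) * t) =
    ((p1 - r1) - (q1 - s1)) * ((p1 - r1) + (q1 - s1)) +
    ((p2 - r2) - (q2 - s2)) * (t * ((p1 - r1) - (q1 - s1))) by ring.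
  rewrite tE.
  have -> : ((p1 - r1) - (q1 - s1)) * ((p1 - r1) + (q1 - s1)) +
    ((p2 - r2) - (q2 - s2)) * ((p2 - r2) + (q2 - s2)) =
    ((p1 - r1) ^+ 2 + (p2 - r2) ^+ 2) - ((q1 - s1) ^+ 2 + (q2 - s2) ^+ 2) by ring.
  by rewrite sd subrr.
split; lra.
Qed.

Lemma translations_le : (#|[set ll | is_translation ll]| <= N ^ 3)%N.
Proof.
pose f (ll : T * T) := (ll.1.1, ll.1.2, ll.2.1).
rewrite -(card_in_imset (f := f)).
  by apply: leq_trans (max_card _) _; rewrite !card_prod !expnS expn0 muln1 mulnA.
move=> [[p q] [r s]] [[p' q'] [r' s']]; rewrite !inE /is_translation /=.
move=> /andP[/eqP h1 /eqP h2] /andP[/eqP h3 /eqP h4] [e1 e2 e3].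
move: h3 h4; rewrite -e1 -e2 -e3 => h3 h4; congr (_, (_, _)).
apply: pos_inj; move: h1 h2 h3 h4.
case: (pos p) (pos q) (pos r) (pos s) (pos s') => [p1 p2] [q1 q2] [r1 r2] [s1 s2] [s1' s2'] /=.
by move=> h1 h2 h3 h4; congr (_, _); lra.
Qed.

(** Summation by parts of the squared multiplicities, from [m^2 <= sum of 2 r for r from 2 to m]
    when [m >= 2]; multiplicity one gives no pair of distinct lines. *)
Lemma meeting_pairs_le :
  (#|[set ll : T * T | (ll.1 != ll.2) && [exists a, inc ll.1 a && inc ll.2 a]]|
   <= \sum_(2 <= r < N.+1) 2 * r * #|rich inc [set: T] r|)%N.
Proof.
pose deg a := #|lines_through inc [set: T] a|.
apply: leq_trans (_ : \sum_(a : Pt) (if (2 <= deg a)%N then deg a ^ 2 else 0) <= _)%N.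
  apply: leq_trans (_ : #|\bigcup_(a : Pt) [set ll : T * T |
     [&& ll.1 != ll.2, inc ll.1 a & inc ll.2 a]]| <= _)%N.
    apply/subset_leq_card/subsetP => ll; rewrite inE => /andP[ne /existsP[a ha]].
    by apply/bigcupP; exists a => //; rewrite inE ne.
  elim/big_rec2: _ => [|a m E _ h]; first by rewrite cards0.
  apply: leq_trans (leq_card_setU _ _) _; apply: leq_add h.
  case: ltnP => deg1.
    rewrite -mulnn -cardsX; apply/subset_leq_card/subsetP => ll.
    by rewrite !inE => /and3P[_ -> ->].
  rewrite leqn0 cards_eq0; apply/eqP/setP => -[l l']; rewrite !inE /=.
  apply/negP => /and3P[ne la l'a]; move/negP: ne; apply; apply/eqP.
  by apply: (card_le1_eqP deg1); rewrite !inE.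
have degN a : (deg a <= N)%N.
  apply: leq_trans (lines_through_le pos_inj px py pt a).
  by apply/subset_leq_card/subsetP => l; rewrite !inE.
apply: leq_trans (_ : \sum_(a : Pt) \sum_(2 <= r < N.+1) 2 * r * (r <= deg a) <= _)%N.
  apply: leq_sum => a _; case: ltnP => // deg2.
  have sqrE m : (1 < m)%N -> (m ^ 2 <= \sum_(2 <= r < m.+1) 2 * r)%N.
    case: m => [|[|m]] // _; elim: m => [|m IHm]; first by rewrite big_nat1.
    by rewrite big_nat_recr //=; move: IHm; rewrite -!mulnn; lia.
  apply: leq_trans (sqrE _ deg2) _.
  have d1 : (2 <= (deg a).+1)%N by apply: leqW.
  have d2 : ((deg a).+1 <= N.+1)%N by rewrite ltnS.
  rewrite (@big_cat_nat _ _ _ (deg a).+1 2 N.+1) //=.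
  apply: leq_trans (leq_addr _ _); rewrite big_nat_cond [X in (_ <= X)%N]big_nat_cond.
  by apply: leq_sum => r /andP[/andP[_ rd] _]; rewrite ltnS in rd; rewrite rd muln1.
rewrite exchange_big /=; apply: leq_sum => r _; rewrite -big_distrr /= leq_mul2l.
apply/orP; right; rewrite -sum1_card [X in (_ <= X)%N]big_mkcond /=; apply: leq_sum => a _.
by rewrite inE; case: (r <= _)%N.
Qed.

Lemma congruent_pairs_le :
  (#|[set ll : T * T | sqr_dist (pos ll.1.1) (pos ll.2.1)
                        == sqr_dist (pos ll.1.2) (pos ll.2.2)]|
   <= N ^ 3 + \sum_(2 <= r < N.+1) 2 * r * #|rich inc [set: T] r|)%N.
Proof.
apply: leq_trans (leq_add translations_le meeting_pairs_le).
apply: leq_trans (leq_card_setU _ _); apply/subset_leq_card/subsetP => -[l l'].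
rewrite !inE /= => /eqP sd; case: (boolP (is_translation (l, l'))) => //= ntr.
apply/andP; split; last by apply/existsP/congruent_pairs_meet.
by apply: contraNneq ntr => ->; rewrite /is_translation /= !subrr eqxx.
Qed.

End DistanceEnergy.

(** [rich_motions_le] bounds the term for [r] by a multiple of [N^(3 + 2 eps) / r]; the harmonic sum
    costs a logarithm, hence the third [eps]. *)
Lemma congruent_pairs_powR (R : realType) (eps : R) : 0 < eps ->
  exists2 C : R, 0 < C & forall (P : finType) (pos : P -> R * R), injective pos ->
  (0 < #|P|)%N ->
  #|[set ll : (P * P) * (P * P) | sqr_dist (pos ll.1.1) (pos ll.2.1)
                        == sqr_dist (pos ll.1.2) (pos ll.2.2)]|%:R
   <= C * #|P|%:R `^ (3 + 3 * eps).
Proof.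
move=> eps0; have [K K0 rich_le] := rich_motions_le eps0.
have ie0 : 0 < eps^-1 by rewrite invr_gt0.
exists (1 + 2 * K * (1 + eps^-1)).
  by rewrite addr_gt0 // !mulr_gt0 // addr_gt0.
move=> P pos posI N0; have NR : 1 <= #|P|%:R :> R by rewrite ler1n.
have NRp : 0 < #|P|%:R :> R by rewrite ltr0n.
apply: le_trans (_ : (#|P| ^ 3 + _)%:R <= _).
  by rewrite ler_nat; apply: (congruent_pairs_le posI).
rewrite natrD mulrDl mul1r; apply: lerD.
  rewrite natrX -powR_mulrn //; apply: ler_powR => //; lra.
pose q := #|P|%:R `^ (3 + 2 * eps) : R.
have q0 : 0 < q by apply: powR_gt0.
have Kq0 : 0 < 2 * (K * q) by rewrite !mulr_gt0.
rewrite natr_sum; apply: le_trans (_ : \sum_(1 <= r < #|P|.+1) 2 * (K * q) * r%:R^-1 <= _).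
  rewrite [X in _ <= X]big_ltn // ler_wpDl //.
    by apply: mulr_ge0; [exact: ltW | rewrite invr_ge0].
  rewrite big_nat_cond [X in _ <= X]big_nat_cond; apply: ler_sum => r /andP[/andP[r2 rN] _].
  have r0 : 0 < r%:R :> R by rewrite ltr0n; apply: leq_trans r2.
  rewrite ler_pdivlMr // -natrM; set X := #|_|.
  rewrite (_ : (2 * r * X * r = 2 * (r ^ 2 * X))%N); last by ring.
  rewrite natrM ler_pM2l //; apply: rich_le => //; last by rewrite r2.
  move=> [[[x y] t] xP] [[[x' y'] t'] x'P] /= [e1 e2 e3]; apply: val_inj => /=.
  by rewrite e1 e2 e3.
rewrite -mulr_sumr; have := harmonic_le R #|P|.-1; rewrite prednK // => harm.
have lnN := ln_le_powR eps0 NR.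
have Neps : 1 <= #|P|%:R `^ eps :> R.
  by rewrite -[X in X <= _](powRr0 #|P|%:R); apply: ler_powR => //; exact: ltW.
apply: le_trans (_ : 2 * (K * q) * ((1 + eps^-1) * #|P|%:R `^ eps) <= _).
  by rewrite ler_pM2l //; apply: le_trans harm _; rewrite mulrDl mul1r lerD.
have -> : #|P|%:R `^ (3 + 3 * eps) = q * #|P|%:R `^ eps :> R.
  rewrite /q -powRD; last by rewrite (gt_eqF NRp) implybT.
  by congr (_ `^ _); lra.
by rewrite le_eqVlt; apply/orP; left; apply/eqP; ring.
Qed.

Local Open Scope fset_scope.

Theorem theorem0p3 (R : realType) (eps : R) (heps : 0 < eps) :
  exists2 c : R, 0 < c &
    forall (N : nat) (P : {fset R * R}),
      (1 <= N)%N -> #|` P| = N ->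
      c * N%:R `^ (1 - eps) <= (#|` distinct_distances P|)%:R.
Proof.
have e3 : 0 < eps / 3 by apply: divr_gt0.
have [C C0 hC] := congruent_pairs_powR e3.
exists C^-1; first by rewrite invr_gt0.
move=> N P N1 cardP; pose pos (p : P) : R * R := val p.
have cP : #|{: P}| = N by rewrite -cardfE.
have memD (w : P * P) : euclidean_dist (pos w.1) (pos w.2) \in distinct_distances P.
  by apply: in_imfset2; apply: valP.
pose f (w : P * P) : distinct_distances P := [` memD w].
have := card_sqr_le_collisions f; rewrite -cardfE card_prod cP => coll.
have pairs : (#|[set ww : (P * P) * (P * P) | f ww.1 == f ww.2]| <=
   #|[set ll : (P * P) * (P * P) | sqr_dist (pos ll.1.1) (pos ll.2.1)
                        == sqr_dist (pos ll.1.2) (pos ll.2.2)]|)%N.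
  (* Equal distances of [(a, b)] and [(c, d)] become the pair of lines [l_ac], [l_bd]. *)
  pose g (ww : (P * P) * (P * P)) := ((ww.1.1, ww.2.1), (ww.1.2, ww.2.2)).
  rewrite -(card_in_imset (f := g)); last first.
    by move=> [[a b] [c d]] [[a' b'] [c' d']] _ _ [-> -> -> ->].
  apply/subset_leq_card/subsetP => _ /imsetP[[[a b] [c d]] + ->].
  rewrite !inE /g /= => /eqP/(congr1 val) /= /eqP.
  by rewrite /euclidean_dist eqr_sqrt ?addr_ge0 ?sqr_ge0.
have hN := hC _ pos val_inj; rewrite cP in hN.
have NR : 0 < N%:R :> R by rewrite ltr0n.
rewrite mulrC ler_pdivrMr //.
have q0 : (0 < N%:R `^ (3 + 3 * (eps / 3)) :> R)%R by apply: powR_gt0.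
rewrite -(ler_pM2r q0) -powRD; last by rewrite (gt_eqF NR) implybT.
(* [N^4] is the square of the number of ordered pairs of points, and it is at most the number of
   distances times the number of collisions. *)
have -> : (1 - eps + (3 + 3 * (eps / 3)) = 4%:R)%R by lra.
rewrite powR_mulrn // -natrX -mulrA.
apply: le_trans (ler_wpM2l (ler0n _ _) (hN N1)).
rewrite -natrM ler_nat; apply: leq_trans (leq_mul (leqnn _) pairs).
by apply: leq_trans coll; rewrite mulnn -expnM.
Qed.
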